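(* (Soundness and Completeness of $\mathbb{AX}^-$) For all $\Phi\cup\{\varphi\}\subseteq Fm(C)$: $\Phi\vdash\varphi\Leftrightarrow\Phi\Vdash\varphi$.
   Context: Syntax. $V=\{x_0,x_1,\dots\}$ is a countable linearly ordered set of variables, $C$ a set of constants with $\top,\bot\in C$; $Fm(C)$ is generated from $V\cup C$ by $\neg,\square$ (unary), $\rightarrow,\vee,\wedge,\equiv$ (binary) and $\forall$, where $\forall x\varphi$ is a formula only if $x\in fvar(\varphi)$ (free variables). Substitutions $\sigma\colon V\cup C\to Fm(C)$ extend homomorphically, with $(\forall x\varphi)[\sigma]=\forall y(\varphi[\sigma[x:=y]])$, $y$ the least variable greater than all variables free in $\sigma(u)$ for $u$ free variable or constant of $\forall x\varphi$; $\varphi[x:=\psi]$ substitutes $\psi$ for $x$; $=_\alpha$ is alpha-congruence (differing at most in bound variables). A substitution $\sigma\colon V\to Fm(C)$ is one fixing all constants. Deduction. $\mathbb{AX}^-$ is the smallest set containing (i) substitution instances of propositional tautologies; (ii) $\square\varphi\rightarrow\varphi$; (iii) $\square(\varphi\rightarrow\psi)\rightarrow(\square\varphi\rightarrow\square\psi)$; (iv) $\square(\varphi\rightarrow\psi)\rightarrow\square(\square\varphi\rightarrow\square\psi)$; (v) $\varphi\equiv\psi$ if $\varphi=_\alpha\psi$; (vi) $(\varphi\equiv\psi)\rightarrow(\varphi\rightarrow\psi)$; (vii) $(\psi\equiv\psi')\rightarrow(\varphi[x:=\psi]\equiv\varphi[x:=\psi'])$ if $x\in fvar(\varphi)$; (ix)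 $\forall x\varphi\rightarrow\varphi[x:=\psi]$; (x) $\forall x(\varphi\rightarrow\psi)\rightarrow(\forall x\varphi\rightarrow\forall x\psi)$; (xi) $\forall x(\varphi\rightarrow\psi)\rightarrow(\varphi\rightarrow\forall x\psi)$ if $x\notin fvar(\varphi)$; (xii) $\square\forall x\varphi\rightarrow\forall x\square\varphi$; and closed under $\varphi\mapsto\forall x\varphi$ for $x\in fvar(\varphi)$. $\Phi\vdash\varphi$ means $\varphi$ is derivable from $\Phi$ using axioms from $\mathbb{AX}^-$, Modus Ponens, and Axiom Necessitation (from an axiom $\varphi\in\mathbb{AX}^-$ infer $\square\varphi$). Semantics. A simple model $\mathcal{M}=(M,\mathit{TRUE},\mathit{NEC},\varGamma)$ consists of a nonempty set $M$, sets $\mathit{NEC}\subseteq\mathit{TRUE}\subseteq M$, a function $\varGamma\colon C\to M$, and, for every assignment $\gamma\colon V\to M$, an extension $\gamma\colon Fm(C)\to M$ (agreeing with $\gamma$ on $V$), such that: (structural) $\gamma(c)=\varGamma(c)$ for all $c\in C$; if $\gamma(x)=\gamma'(x)$ for all $x\in fvar(\varphi)$ then $\gamma(\varphi)=\gamma'(\varphi)$; for every substitution $\sigma\colon V\to Fm(C)$, $\gamma(\varphi[\sigma])=\gamma\sigma(\varphi)$, where $\gamma\sigma$ is the assignment $x\mapsto\gamma(\sigma(x))$; (truth conditions) for all $\gamma,\varphi,\psi$: $\varGamma(\bot)\notin\mathit{TRUE}$, $\varGamma(\top)\in\mathit{TRUE}$; $\gamma(\varphi\rightarrow\psi)\in\mathit{TRUE}\Leftrightarrow(\gamma(\varphi)\notin\mathit{TRUE}$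 or $\gamma(\psi)\in\mathit{TRUE})$; $\gamma(\neg\varphi)\in\mathit{TRUE}\Leftrightarrow\gamma(\varphi)\notin\mathit{TRUE}$; $\wedge,\vee$ classical likewise; $\gamma(\square\varphi)\in\mathit{TRUE}\Leftrightarrow\gamma(\varphi)\in\mathit{NEC}$; $\gamma(\varphi\equiv\psi)\in\mathit{TRUE}\Leftrightarrow\gamma(\varphi)=\gamma(\psi)$; $\gamma(\forall x\varphi)\in\mathit{TRUE}\Leftrightarrow\gamma^a_x(\varphi)\in\mathit{TRUE}$ for all $a\in M$ (where $\gamma^a_x$ maps $x$ to $a$ and agrees with $\gamma$ elsewhere); if $\gamma(\varphi\rightarrow\psi)\in\mathit{NEC}$ then $\gamma(\square\varphi\rightarrow\square\psi)\in\mathit{NEC}$; if $\gamma(\forall x\varphi)\in\mathit{NEC}$ then $\gamma^a_x(\varphi)\in\mathit{NEC}$ for all $a\in M$. An assignment $\gamma$ is admissible if $\gamma(\varphi)\in\mathit{NEC}$ for every $\varphi\in\mathbb{AX}^-$; $\mathcal{M}$ is admissible if every assignment is. $(\mathcal{M},\gamma)\vDash\varphi:\Leftrightarrow\gamma(\varphi)\in\mathit{TRUE}$. $\Phi\Vdash\varphi$ means: for every admissible simple model $\mathcal{M}$ and assignment $\gamma$, if $(\mathcal{M},\gamma)\vDash\psi$ for all $\psi\in\Phi$ then $(\mathcal{M},\gamma)\vDash\varphi$. *)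

(* Defs.v *)
From mathcomp Require Import all_boot.

Set Implicit Arguments.
Unset Strict Implicit.
Unset Printing Implicit Defensive.

(* The variable x_i is represented by the natural number i. *)
Notation V := nat (only parsing).

(* Raw formulas do not enforce that a quantified variable is free in the body;
   Fm C below is the subtype that does. *)
Inductive raw (C : Type) : Type :=
  | RVar of V
  | RCon of C
  | RNot of raw C
  | RBox of raw C
  | RImp of raw C & raw C
  | ROr  of raw C & raw C
  | RAnd of raw C & raw C
  | REqv of raw C & raw C
  | RAll of V & raw C.

Arguments RVar {C} _.

Fixpoint rfvar (C : Type) (f : raw C) : seq nat :=
  match f with
  | RVar x => [:: x]
  | RCon _ => [::]
  | RNot g | RBox g => rfvar g
  | RImp g h | ROr g h | RAnd g h | REqv g h => rfvar g ++ rfvar h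
  | RAll x g => [seq z <- rfvar g | z != x]
  end.

Fixpoint rcon (C : Type) (f : raw C) : seq C :=
  match f with
  | RVar _ => [::]
  | RCon c => [:: c]
  | RNot g | RBox g | RAll _ g => rcon g
  | RImp g h | ROr g h | RAnd g h | REqv g h => rcon g ++ rcon h
  end.

Fixpoint wf (C : Type) (f : raw C) : bool :=
  match f with
  | RVar _ | RCon _ => true
  | RNot g | RBox g => wf g
  | RImp g h | ROr g h | RAnd g h | REqv g h => wf g && wf h
  | RAll x g => (x \in rfvar g) && wf g
  end.

(* The least variable greater than every free variable of f (0 if none). *)
Definition rbound (C : Type) (f : raw C) : nat :=
  \max_(v <- rfvar f) v.+1.

Definition rupd (C : Type) (s : V + C -> raw C) (x : V) (g : raw C)
    (u : V + C) : raw C :=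
  match u with
  | inl z => if z == x then g else s u
  | inr _ => s u
  end.

(* The least variable greater than all variables free in s u, for u a free
   variable or a constant of f. *)
Definition rfresh (C : Type) (s : V + C -> raw C) (f : raw C) : nat :=
  maxn (\max_(z <- rfvar f) rbound (s (inl z)))
       (\max_(c <- rcon f) rbound (s (inr c))).

Fixpoint rsubst (C : Type) (s : V + C -> raw C) (f : raw C) : raw C :=
  match f with
  | RVar x => s (inl x)
  | RCon c => s (inr c)
  | RNot g => RNot (rsubst s g)
  | RBox g => RBox (rsubst s g)
  | RImp g h => RImp (rsubst s g) (rsubst s h)
  | ROr g h => ROr (rsubst s g) (rsubst s h)
  | RAnd g h => RAnd (rsubst s g) (rsubst s h)
  | REqv g h => REqv (rsubst s g) (rsubst s h)
  | RAll x g =>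
      let y := rfresh s (RAll x g) in
      RAll y (rsubst (rupd s x (RVar y)) g)
  end.

Lemma rbound_gt (C : Type) (f : raw C) (v : nat) : v \in rfvar f -> v < rbound f.
Proof. by move=> vf; rewrite /rbound (leq_bigmax_seq (F := succn)). Qed.

Lemma rfvar_rsubst (C : Type) (f : raw C) (s : V + C -> raw C) (u v : nat) :
  u \in rfvar f -> v \in rfvar (s (inl u)) -> v \in rfvar (rsubst s f).
Proof.
elim: f s u v => [x|c|g IHg|g IHg|g IHg h IHh|g IHg h IHh|g IHg h IHh
  |g IHg h IHh|x g IHg] s u v //=; rewrite ?mem_cat.
- by rewrite inE => /eqP ->.
- exact: IHg.
- exact: IHg.
- by move=> /orP[/IHg H|/IHh H] /H ->; rewrite ?orbT.
- by move=> /orP[/IHg H|/IHh H] /H ->; rewrite ?orbT.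
- by move=> /orP[/IHg H|/IHh H] /H ->; rewrite ?orbT.
- by move=> /orP[/IHg H|/IHh H] /H ->; rewrite ?orbT.
move=> ux vu; rewrite mem_filter; apply/andP; split.
  rewrite neq_ltn; apply/orP; left.
  apply: leq_trans (rbound_gt vu) (leq_trans _ (leq_maxl _ _)).
  exact: (leq_bigmax_seq (F := fun z : nat => rbound (s (inl z)))).
move: ux; rewrite mem_filter => /andP[ux ug].
by apply: (IHg _ u) => //=; rewrite (negbTE ux).
Qed.

Lemma wf_rsubst (C : Type) (f : raw C) (s : V + C -> raw C) :
  (forall u, wf (s u)) -> wf f -> wf (rsubst s f).
Proof.
elim: f s => [x|c|g IHg|g IHg|g IHg h IHh|g IHg h IHh|g IHg h IHh
  |g IHg h IHh|x g IHg] s ws //=; try by [exact: IHg|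
  move=> /andP[wg wh]; rewrite IHg ?IHh].
move=> /andP[xg wg]; apply/andP; split.
  by apply: (rfvar_rsubst xg) => /=; rewrite eqxx inE.
by apply: IHg => // -[z|c] /=; [case: ifP|].
Qed.

Record Fm (C : Type) : Type := MkFm { fraw :> raw C; fwf : wf fraw }.

Definition fvar (C : Type) (f : Fm C) : seq nat := rfvar f.

Definition fVar (C : Type) (x : V) : Fm C := @MkFm C (RVar x) isT.
Arguments fVar {C} x.
Definition fCon (C : Type) (c : C) : Fm C := @MkFm C (RCon c) isT.
Definition fNot (C : Type) (f : Fm C) : Fm C := @MkFm C (RNot f) (fwf f).
Definition fBox (C : Type) (f : Fm C) : Fm C := @MkFm C (RBox f) (fwf f).
Definition fImp (C : Type) (f g : Fm C) : Fm C :=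
  @MkFm C (RImp f g) (introT andP (conj (fwf f) (fwf g))).
Definition fOr (C : Type) (f g : Fm C) : Fm C :=
  @MkFm C (ROr f g) (introT andP (conj (fwf f) (fwf g))).
Definition fAnd (C : Type) (f g : Fm C) : Fm C :=
  @MkFm C (RAnd f g) (introT andP (conj (fwf f) (fwf g))).
Definition fEqv (C : Type) (f g : Fm C) : Fm C :=
  @MkFm C (REqv f g) (introT andP (conj (fwf f) (fwf g))).
Definition fAll (C : Type) (x : V) (f : Fm C) (h : x \in fvar f) : Fm C :=
  @MkFm C (RAll x f) (introT andP (conj h (fwf f))).
Arguments fAll {C} x f h.

Definition subst (C : Type) (s : V + C -> Fm C) (f : Fm C) : Fm C :=
  @MkFm C (rsubst (fun u => s u) f) (wf_rsubst (fun u => fwf (s u)) (fwf f)).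

Definition vsubst (C : Type) (s : V -> Fm C) (u : V + C) : Fm C :=
  match u with inl x => s x | inr c => fCon c end.

Definition upd (T : Type) (g : V -> T) (x : V) (a : T) (z : V) : T :=
  if z == x then a else g z.

Definition subst1 (C : Type) (f : Fm C) (x : V) (g : Fm C) : Fm C :=
  subst (vsubst (upd fVar x g)) f.

(* Alpha-congruence: the least congruence generated by renaming one bound
   variable. *)
Inductive alpha (C : Type) : Fm C -> Fm C -> Prop :=
  | alpha_rename (x y : V) (f : Fm C) (hx : x \in fvar f)
      (hy : y \in fvar (subst1 f x (fVar y))) :
      y \notin fvar (fAll x f hx) ->
      alpha (fAll x f hx) (fAll y (subst1 f x (fVar y)) hy)
  | alpha_refl f : alpha f f
  | alpha_sym f g : alpha f g -> alpha g f
  | alpha_trans f g h : alpha f g -> alpha g h -> alpha f h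
  | alpha_not f f' : alpha f f' -> alpha (fNot f) (fNot f')
  | alpha_box f f' : alpha f f' -> alpha (fBox f) (fBox f')
  | alpha_imp f f' g g' :
      alpha f f' -> alpha g g' -> alpha (fImp f g) (fImp f' g')
  | alpha_or f f' g g' :
      alpha f f' -> alpha g g' -> alpha (fOr f g) (fOr f' g')
  | alpha_and f f' g g' :
      alpha f f' -> alpha g g' -> alpha (fAnd f g) (fAnd f' g')
  | alpha_eqv f f' g g' :
      alpha f f' -> alpha g g' -> alpha (fEqv f g) (fEqv f' g')
  | alpha_all (x : V) (f f' : Fm C) (h : x \in fvar f)
      (h' : x \in fvar f') :
      alpha f f' -> alpha (fAll x f h) (fAll x f' h').

Inductive pform : Type :=
  | PVar of V
  | PTop
  | PBot
  | PNot of pform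
  | PImp of pform & pform
  | POr  of pform & pform
  | PAnd of pform & pform.

Fixpoint peval (v : V -> bool) (p : pform) : bool :=
  match p with
  | PVar x => v x
  | PTop => true
  | PBot => false
  | PNot q => ~~ peval v q
  | PImp q r => peval v q ==> peval v r
  | POr q r => peval v q || peval v r
  | PAnd q r => peval v q && peval v r
  end.

Definition tautology (p : pform) : Prop := forall v, peval v p = true.

Fixpoint pembed (C : Type) (top bot : C) (p : pform) : Fm C :=
  match p with
  | PVar x => fVar x
  | PTop => fCon top
  | PBot => fCon bot
  | PNot q => fNot (pembed top bot q)
  | PImp q r => fImp (pembed top bot q) (pembed top bot r)
  | POr q r => fOr (pembed top bot q) (pembed top bot r)
  | PAnd q r => fAnd (pembed top bot q) (pembed top bot r)
  end.

(* In the quantifier axioms, the membership arguments of fAll are exactly the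
   conditions under which the axiom is a formula. *)
Inductive AX (C : Type) (top bot : C) : Fm C -> Prop :=
  | ax_taut (p : pform) (s : V -> Fm C) :
      tautology p -> AX top bot (subst (vsubst s) (pembed top bot p))
  | ax_T f : AX top bot (fImp (fBox f) f)
  | ax_K f g :
      AX top bot (fImp (fBox (fImp f g)) (fImp (fBox f) (fBox g)))
  | ax_S3 f g :
      AX top bot (fImp (fBox (fImp f g)) (fBox (fImp (fBox f) (fBox g))))
  | ax_alpha f g : alpha f g -> AX top bot (fEqv f g)
  | ax_eqv_imp f g : AX top bot (fImp (fEqv f g) (fImp f g))
  | ax_eqv_subst (f g g' : Fm C) (x : V) :
      x \in fvar f ->
      AX top bot (fImp (fEqv g g') (fEqv (subst1 f x g) (subst1 f x g')))
  | ax_inst (x : V) (f g : Fm C) (h : x \in fvar f) :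
      AX top bot (fImp (fAll x f h) (subst1 f x g))
  | ax_all_imp (x : V) (f g : Fm C) (h : x \in fvar (fImp f g))
      (hf : x \in fvar f) (hg : x \in fvar g) :
      AX top bot
        (fImp (fAll x (fImp f g) h) (fImp (fAll x f hf) (fAll x g hg)))
  | ax_all_imp_r (x : V) (f g : Fm C) (h : x \in fvar (fImp f g))
      (hg : x \in fvar g) :
      x \notin fvar f ->
      AX top bot (fImp (fAll x (fImp f g) h) (fImp f (fAll x g hg)))
  | ax_box_all (x : V) (f : Fm C) (h : x \in fvar f)
      (h' : x \in fvar (fBox f)) :
      AX top bot (fImp (fBox (fAll x f h)) (fAll x (fBox f) h'))
  | ax_gen (x : V) (f : Fm C) (h : x \in fvar f) :
      AX top bot f -> AX top bot (fAll x f h).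

Inductive derives (C : Type) (top bot : C) (Phi : Fm C -> Prop) :
    Fm C -> Prop :=
  | der_hyp f : Phi f -> derives top bot Phi f
  | der_ax f : AX top bot f -> derives top bot Phi f
  | der_mp f g :
      derives top bot Phi f -> derives top bot Phi (fImp f g) ->
      derives top bot Phi g
  | der_nec f : AX top bot f -> derives top bot Phi (fBox f).

Record simple_model (C : Type) (top bot : C) : Type := SimpleModel {
  carrier : Type;
  TRUE : carrier -> Prop;
  NEC : carrier -> Prop;
  Gamma : C -> carrier;
  ext : (V -> carrier) -> Fm C -> carrier;
  carrier_inhabited : inhabited carrier;
  NEC_TRUE : forall a, NEC a -> TRUE a;
  ext_var : forall g x, ext g (fVar x) = g x;
  ext_con : forall g c, ext g (fCon c) = Gamma c;
  ext_coincidence : forall g g' f,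
    (forall x : V, x \in fvar f -> g x = g' x) -> ext g f = ext g' f;
  ext_subst : forall g (s : V -> Fm C) f,
    ext g (subst (vsubst s) f) = ext (fun x => ext g (s x)) f;
  true_bot : ~ TRUE (Gamma bot);
  true_top : TRUE (Gamma top);
  true_imp : forall g f h,
    TRUE (ext g (fImp f h)) <-> (~ TRUE (ext g f) \/ TRUE (ext g h));
  true_not : forall g f, TRUE (ext g (fNot f)) <-> ~ TRUE (ext g f);
  true_and : forall g f h,
    TRUE (ext g (fAnd f h)) <-> (TRUE (ext g f) /\ TRUE (ext g h));
  true_or : forall g f h,
    TRUE (ext g (fOr f h)) <-> (TRUE (ext g f) \/ TRUE (ext g h));
  true_box : forall g f, TRUE (ext g (fBox f)) <-> NEC (ext g f);
  true_eqv : forall g f h, TRUE (ext g (fEqv f h)) <-> ext g f = ext g h;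
  true_all : forall g (x : V) f (hx : x \in fvar f),
    TRUE (ext g (fAll x f hx)) <-> forall a, TRUE (ext (upd g x a) f);
  nec_imp : forall g f h,
    NEC (ext g (fImp f h)) -> NEC (ext g (fImp (fBox f) (fBox h)));
  nec_all : forall g (x : V) f (hx : x \in fvar f),
    NEC (ext g (fAll x f hx)) -> forall a, NEC (ext (upd g x a) f)
}.

Definition admissible_assignment (C : Type) (top bot : C)
    (M : simple_model top bot) (g : V -> carrier M) : Prop :=
  forall f, AX top bot f -> NEC (ext g f).

Definition admissible (C : Type) (top bot : C) (M : simple_model top bot) :
    Prop :=
  forall g : V -> carrier M, admissible_assignment g.

Definition satisfies (C : Type) (top bot : C) (M : simple_model top bot)
    (g : V -> carrier M) (f : Fm C) : Prop :=
  TRUE (ext g f).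

Definition entails (C : Type) (top bot : C) (Phi : Fm C -> Prop) (f : Fm C) :
    Prop :=
  forall M : simple_model top bot, admissible M ->
  forall g : V -> carrier M,
    (forall h, Phi h -> satisfies g h) -> satisfies g f.

(* Main.v *)
(* Substitution renames every bound variable to the least variable that is fresh
   for the result.  Therefore substitutions compose strictly, alpha-congruent
   formulas have equal substitution instances, and the set of axioms is closed
   under substitution up to alpha-congruence.
   For completeness, a set not deriving phi is moved to a language in which every
   universal formula has its own witnessing constant, and the witnessing
   implications are added.  This is conservative: among finitely many of them,
   one of maximal rank has a witness that occurs nowhere else, and such a
   constant can be replaced by a fresh variable and generalized.  A maximal
   consistent extension T yields a model on the formulas modulo T-provable
   identity, an assignment being evaluated by substituting representatives; its
   reduct to the original language refutes phi. *)
From mathcomp Require Import all_boot.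
From mathcomp Require Import boolp classical_sets.
From Stdlib Require List.
Require Import Defs.

Set Implicit Arguments.
Unset Strict Implicit.
Unset Printing Implicit Defensive.

(** * Capture-avoiding substitution on raw formulas *)

Section Substitution.
Variable C : Type.
Implicit Types (f g : raw C) (s t : V + C -> raw C) (u w : V + C).

(** Variables and constants are treated alike because substitutions act on both. Constants use
    [List.In], as [C] need not have decidable equality. *)
Definition occ f u : Prop :=
  match u with inl x => x \in rfvar f | inr c => List.In c (rcon f) end.

Lemma In_cat (T : Type) (x : T) (l1 l2 : seq T) :
  List.In x (l1 ++ l2) <-> List.In x l1 \/ List.In x l2.
Proof.
elim: l1 => [|a l1 IH] /=; first by split=> [?|[]//]; right.
by rewrite IH; tauto.
Qed.

Lemma occ_imp f g u : occ (RImp f g) u <-> occ f u \/ occ g u.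
Proof.
case: u => [x|c] /=; last exact: In_cat.
by rewrite mem_cat; split => /orP.
Qed.

Lemma occ_all x f u : occ (RAll x f) u <-> occ f u /\ u <> inl x.
Proof.
case: u => [z|c] /=; last by split=> [?|[]//]; split.
rewrite mem_filter; split=> [/andP[/eqP zx zf]|[zf zx]].
  by split=> // -[].
by rewrite zf andbT; apply/eqP => zx'; apply: zx; rewrite zx'.
Qed.

Lemma rbound_leP f n : rbound f <= n <-> (forall v, v \in rfvar f -> v < n).
Proof.
split=> [fn v /rbound_gt vf|fn]; first exact: leq_trans vf fn.
by apply/bigmax_leqP_seq => v vf _; exact: fn.
Qed.

Lemma bigmax_In_leP (T : Type) (l : seq T) (F : T -> nat) n :
  \max_(c <- l) F c <= n <-> (forall c, List.In c l -> F c <= n).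
Proof.
elim: l => [|a l IH]; first by rewrite big_nil.
rewrite big_cons geq_max; split=> [/andP[an /IH ln] c /= [<-//|]|ln].
  exact: ln.
by rewrite ln /=; [apply/IH => c cl; apply: ln; right|left].
Qed.

Lemma rfresh_leP s f n :
  rfresh s f <= n <-> (forall u v, occ f u -> v \in rfvar (s u) -> v < n).
Proof.
rewrite /rfresh geq_max; split=> [/andP[fn cn] [x|c] v uf|fn].
- by move: v; apply/rbound_leP; apply: leq_trans fn; apply: leq_bigmax_seq.
- by move: v; apply/rbound_leP; move/bigmax_In_leP: cn => /(_ c uf).
apply/andP; split.
  apply/bigmax_leqP_seq => x xf _; apply/rbound_leP => v; exact: (fn (inl x)).
by apply/bigmax_In_leP => c cf; apply/rbound_leP => v; exact: (fn (inr c)).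
Qed.

Lemma rfreshP s f u : occ f u -> rfresh s f \notin rfvar (s u).
Proof.
move=> uf; apply/negP => ufr.
have /rfresh_leP/(_ u _ uf ufr) := leqnn (rfresh s f).
by rewrite ltnn.
Qed.

Lemma eq_rfresh s t f g :
  (forall v, (exists2 u, occ f u & v \in rfvar (s u)) <->
             (exists2 u, occ g u & v \in rfvar (t u))) ->
  rfresh s f = rfresh t g.
Proof.
move=> st; apply/eqP; rewrite eqn_leq; apply/andP; split.
  apply/rfresh_leP => u v uf vu.
  have [w wg vw] : exists2 w, occ g w & v \in rfvar (t w) by apply/st; exists u.
  by have /rfresh_leP := leqnn (rfresh t g); apply; first exact: wg.
apply/rfresh_leP => u v uf vu.
have [w wg vw] : exists2 w, occ f w & v \in rfvar (s w) by apply/st; exists u.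
by have /rfresh_leP := leqnn (rfresh s f); apply; first exact: wg.
Qed.

Lemma rsubst_ext s t f :
  (forall u, occ f u -> s u = t u) -> rsubst s f = rsubst t f.
Proof.
elim: f s t => [x|c|g IHg|g IHg|g IHg h IHh|g IHg h IHh|g IHg h IHh
  |g IHg h IHh|x g IHg] s t st /=.
- by apply: st => /=; rewrite inE.
- by apply: st => /=; left.
1,2: by rewrite (IHg s t).
1-4: by rewrite (IHg s t) ?(IHh s t) // => u uf; apply: st;
  apply/(occ_imp g h); [right|left].
have -> : rfresh s (RAll x g) = rfresh t (RAll x g).
  by apply: eq_rfresh => v; split=> -[u ug vu]; exists u; rewrite // ?st // -st.
congr (RAll _ _); apply: IHg => -[z|c] zg /=; last exact: st.
by case: eqP => // zx; apply: st; apply/occ_all; split=> // -[].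
Qed.

Lemma occ_rsubst s f w :
  occ (rsubst s f) w <-> exists2 u, occ f u & occ (s u) w.
Proof.
elim: f s w => [x|c|g IHg|g IHg|g IHg h IHh|g IHg h IHh|g IHg h IHh
  |g IHg h IHh|x g IHg] s w.
- split=> [xw|[[z|c] //=]]; last by rewrite inE => /eqP->.
  by exists (inl x) => //=; rewrite inE.
- split=> [cw|[[z|d] //=]]; last by case=> [->|].
  by exists (inr c) => //=; left.
1,2: exact: IHg.
1-4: have /= bin := occ_imp (rsubst s g) (rsubst s h) w;
  apply: (iff_trans bin); rewrite IHg IHh;
  split=> [[] [u ug uw]|[u /(occ_imp g h)[] ug uw]];
  [exists u => //; apply/(occ_imp g h); left
  |exists u => //; apply/(occ_imp g h); right
  |left; exists u|right; exists u]; done.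
rewrite [rsubst _ _]/= occ_all IHg; split=> [[[u ug uw] wy]|[u uxg uw]].
  exists u; last by case: u ug uw => //= z _; case: eqP => //= _; case: w wy => //= a ay;
    rewrite inE => /eqP ay'; case: ay; rewrite ay'.
  apply/occ_all; split=> // ux; move: uw; rewrite ux /= eqxx.
  by case: w wy => //= a ay; rewrite inE => /eqP ay'; case: ay; rewrite ay'.
have [ug ux] := iffLR (occ_all x g u) uxg; split.
  exists u => //; case: u ug ux uw {uxg} => //= z _ zx.
  by case: eqP => // zx'; case: zx; rewrite zx'.
by move=> wy; move: (rfreshP s uxg); rewrite wy in uw; rewrite uw.
Qed.

(** [y] is any variable fresh for the images, so this covers both the variable picked by [rsubst]
    and an arbitrary renaming. Composition on the body is a premise, which lets an induction on
    formulas supply it. *)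
Lemma rsubst_all_comp x y s t f :
  (forall s' t', rsubst t' (rsubst s' f) = rsubst (fun u => rsubst t' (s' u)) f) ->
  (forall u, occ (RAll x f) u -> y \notin rfvar (s u)) ->
  rsubst t (RAll y (rsubst (rupd s x (RVar y)) f)) =
  rsubst (fun u => rsubst t (s u)) (RAll x f).
Proof.
move=> comp yfresh /=.
have -> : rfresh t (RAll y (rsubst (rupd s x (RVar y)) f)) =
    rfresh (fun u => rsubst t (s u)) (RAll x f).
  apply: eq_rfresh => v; split.
    move=> [w /occ_all[/occ_rsubst[u uf uw] wy] vw].
    have [ux|ux] := pselect (u = inl x).
      move: uw; rewrite ux /= eqxx; case: w wy vw => //= a ay _.
      by rewrite inE => /eqP ay'; case: ay; rewrite ay'.
    exists u; first exact/occ_all.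
    apply/(occ_rsubst t (s u) (inl v)); exists w => //.
    case: u uf uw ux => //= z zf; case: eqP => // -> _.
    by move=> /(_ erefl).
  move=> [u uxf /(occ_rsubst t (s u) (inl v))[w wu vw]]; exists w => //.
  have [uf ux] := iffLR (occ_all x f u) uxf; apply/occ_all; split.
    apply/occ_rsubst; exists u => //; case: u uf ux wu {uxf} => //= z _ zx.
    by case: eqP => // zx'; case: zx; rewrite zx'.
  by move=> wy; move: (yfresh u uxf); rewrite wy in wu; rewrite wu.
congr (RAll _ _); rewrite comp; apply: rsubst_ext => u uf.
(* For [u] other than [x], freshness keeps [y] out of [s u], so the update at [y] is invisible
   there. *)
have aux : u <> inl x -> rsubst (rupd t y (RVar
    (rfresh (fun u => rsubst t (s u)) (RAll x f)))) (s u) = rsubst t (s u).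
  move=> ux; apply: rsubst_ext => -[v|//] vu /=; case: eqP => // vy.
  have uxf : occ (RAll x f) u by apply/occ_all.
  by move: (yfresh u uxf); rewrite -vy vu.
case: u uf aux => [z|c] uf aux /=; last exact: aux.
by case: eqP => [_|zx] /=; [rewrite eqxx|apply: aux => -[]].
Qed.

(* The bound variable chosen by [rsubst] depends only on the free variables of
   the result, so composition holds on the nose and not merely up to
   alpha-congruence. *)
Lemma rsubst_comp s t f :
  rsubst t (rsubst s f) = rsubst (fun u => rsubst t (s u)) f.
Proof.
elim: f s t => [x|c|g IHg|g IHg|g IHg h IHh|g IHg h IHh|g IHg h IHh
  |g IHg h IHh|x g IHg] s t //; try by rewrite /= ?IHg ?IHh.
by apply: rsubst_all_comp => u *; [exact: IHg|exact: rfreshP].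
Qed.

(** Applying this substitution renames every bound variable to its canonical choice, so
    [rsubst idS f] serves as a normal form for alpha-congruence. *)
Definition idS : V + C -> raw C :=
  fun u => match u with inl x => RVar x | inr c => RCon c end.

Lemma rsubst_idS s u : rsubst s (idS u) = s u.
Proof. by case: u. Qed.

Lemma occ_idS u w : occ (idS u) w <-> w = u.
Proof.
case: u w => [x|c] [z|d] //=; rewrite ?inE; split=> //.
- by move/eqP->.
- by case=> ->.
- by case=> // ->.
by case=> ->; left.
Qed.

Lemma occ_rsubst_idS f w : occ (rsubst idS f) w <-> occ f w.
Proof.
rewrite occ_rsubst; split=> [[u uf /occ_idS->//]|wf].
by exists w => //; apply/occ_idS.
Qed.

End Substitution.

(** * Alpha-congruence and its interplay with substitution *)

Section AlphaCongruence.
Variable C : Type.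
Implicit Types (f g h : Fm C) (s t : V + C -> Fm C) (u : V + C).

Lemma Fm_inj f g : fraw f = fraw g -> f = g.
Proof.
case: f g => [f wf] [g wg] /= fg; move: wf wg; rewrite fg => wf wg.
by rewrite (bool_irrelevance wf wg).
Qed.

Lemma Fm_ind (P : Fm C -> Prop) :
  (forall x, P (fVar x)) -> (forall c, P (fCon c)) ->
  (forall f, P f -> P (fNot f)) -> (forall f, P f -> P (fBox f)) ->
  (forall f g, P f -> P g -> P (fImp f g)) ->
  (forall f g, P f -> P g -> P (fOr f g)) ->
  (forall f g, P f -> P g -> P (fAnd f g)) ->
  (forall f g, P f -> P g -> P (fEqv f g)) ->
  (forall x f hx, P f -> P (fAll x f hx)) -> forall f, P f.
Proof.
move=> Pv Pc Pn Pb Pi Po Pa Pe Pq [f wf].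
elim: f wf => [x|c|g IHg|g IHg|g IHg h IHh|g IHg h IHh|g IHg h IHh
  |g IHg h IHh|x g IHg] wf.
- by rewrite (_ : MkFm wf = fVar x); [|exact: Fm_inj].
- by rewrite (_ : MkFm wf = fCon c); [|exact: Fm_inj].
- rewrite (_ : MkFm wf = fNot (MkFm (wf : Defs.wf g))); last exact: Fm_inj.
  exact: Pn.
- rewrite (_ : MkFm wf = fBox (MkFm (wf : Defs.wf g))); last exact: Fm_inj.
  exact: Pb.
- have /andP[wg wh] := wf.
  rewrite (_ : MkFm wf = fImp (MkFm wg) (MkFm wh)); last exact: Fm_inj.
  exact: Pi.
- have /andP[wg wh] := wf.
  rewrite (_ : MkFm wf = fOr (MkFm wg) (MkFm wh)); last exact: Fm_inj.
  exact: Po.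
- have /andP[wg wh] := wf.
  rewrite (_ : MkFm wf = fAnd (MkFm wg) (MkFm wh)); last exact: Fm_inj.
  exact: Pa.
- have /andP[wg wh] := wf.
  rewrite (_ : MkFm wf = fEqv (MkFm wg) (MkFm wh)); last exact: Fm_inj.
  exact: Pe.
have /andP[xg wg] := wf.
rewrite (_ : MkFm wf = @fAll C x (MkFm wg) xg); last exact: Fm_inj.
exact: Pq.
Qed.

Lemma alpha_rsubst f g (s : V + C -> raw C) :
  alpha f g -> rsubst s f = rsubst s g.
Proof.
move=> fg; elim: fg s => {f g}.
- move=> x y f hx hy yf s; rewrite [fraw (fAll x _ _)]/= [fraw (fAll y _ _)]/=.
  (* Composing with [idS] exhibits the renaming of [x] to [y] as an instance of
     [rsubst_all_comp]. *)
  transitivity (rsubst (fun u => rsubst s (idS u)) (RAll x f)).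
    by apply: rsubst_ext => u _; rewrite rsubst_idS.
  rewrite -(@rsubst_all_comp _ x y (@idS C)).
  + congr (rsubst s (RAll y _)); apply: rsubst_ext => -[z|//] _ /=.
    by rewrite /upd; case: eqP.
  + by move=> *; exact: rsubst_comp.
  + move=> u uf; apply/negP => /(occ_idS u (inl y)) yu.
    by move: yf; rewrite /fvar /=; move: uf; rewrite -yu /= => ->.
- by [].
- by move=> f g _ IH s; rewrite IH.
- by move=> f g h _ IH1 _ IH2 s; rewrite IH1.
1,2: by move=> f g _ IH s; rewrite /= IH.
1-4: by move=> f f' g g' _ IH1 _ IH2 s; rewrite /= IH1 IH2.
move=> x f f' h h' _ IH s /=.
have ff' u : occ f u <-> occ f' u.
  by rewrite -(occ_rsubst_idS f) IH occ_rsubst_idS.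
have -> : rfresh s (RAll x f) = rfresh s (RAll x f').
  by apply: eq_rfresh => v; split=> -[u /occ_all[uf ux] vu]; exists u => //;
    apply/occ_all; split=> //; apply/ff'.
by rewrite IH.
Qed.

Lemma alpha_occ f g u : alpha f g -> occ f u <-> occ g u.
Proof.
move=> /(alpha_rsubst (@idS C)) fg.
by rewrite -(occ_rsubst_idS f) fg occ_rsubst_idS.
Qed.

Lemma alpha_eq f g : fraw f = fraw g -> alpha f g.
Proof. by move/Fm_inj ->; exact: alpha_refl. Qed.

Lemma alpha_id f : alpha f (subst (vsubst fVar) f).
Proof.
elim/Fm_ind: f => [x|c|f IH|f IH|f g IHf IHg|f g IHf IHg|f g IHf IHg
  |f g IHf IHg|x f hx IH].
- exact: alpha_eq.
- exact: alpha_eq.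
- by apply: alpha_trans (alpha_not IH) _; exact: alpha_eq.
- by apply: alpha_trans (alpha_box IH) _; exact: alpha_eq.
- by apply: alpha_trans (alpha_imp IHf IHg) _; exact: alpha_eq.
- by apply: alpha_trans (alpha_or IHf IHg) _; exact: alpha_eq.
- by apply: alpha_trans (alpha_and IHf IHg) _; exact: alpha_eq.
- by apply: alpha_trans (alpha_eqv IHf IHg) _; exact: alpha_eq.
(* Renaming [x] to the variable that substitution would choose yields the substituted formula
   literally. *)
set y := rfresh (fun u => vsubst fVar u) (RAll x f).
have hy : y \in fvar (subst1 f x (fVar y)).
  apply: (rfvar_rsubst hx); rewrite /= /upd eqxx; exact: mem_head.
apply: alpha_trans (alpha_rename (y := y) (hx := hx) hy _) _.
  apply/negP => yf.
  have := @rfreshP C (fun u => vsubst fVar u) (RAll x f) (inl y) yf.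
  by rewrite /= mem_head.
apply: alpha_eq => /=; congr (RAll _ _); apply: rsubst_ext => -[z|//] _ /=.
by rewrite /upd; case: eqP.
Qed.

(** Each formula is alpha-congruent to its normal form under [idS]. Together with [alpha_rsubst]
    this turns alpha-congruence into an equation. *)
Lemma alphaP f g : rsubst (@idS C) f = rsubst (@idS C) g -> alpha f g.
Proof.
move=> fg; apply: alpha_trans (alpha_id f) _; apply: alpha_sym.
apply: alpha_trans (alpha_id g) _; apply: alpha_eq => /=.
have idE (r : raw C) : rsubst (fun u => vsubst fVar u) r = rsubst (@idS C) r.
  by apply: rsubst_ext => -[].
by rewrite !idE.
Qed.

Definition updS s (x : V) f u : Fm C :=
  match u with inl z => if z == x then f else s u | inr _ => s u end.

Lemma updS_rupd s x f u : updS s x f u = rupd (fun v => s v) x f u :> raw C.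
Proof. by case: u => //= z; case: eqP. Qed.

Lemma alpha_subst_ext s t f :
  (forall u, occ f u -> alpha (s u) (t u)) -> alpha (subst s f) (subst t f).
Proof.
move=> st; apply: alphaP; rewrite /= !rsubst_comp; apply: rsubst_ext => u uf.
by apply: alpha_rsubst; exact: st.
Qed.

Lemma subst_comp s t f : subst t (subst s f) = subst (fun u => subst t (s u)) f.
Proof. by apply: Fm_inj; rewrite /= rsubst_comp. Qed.

Lemma subst_ext s t f :
  (forall u, occ f u -> s u = t u) -> subst s f = subst t f.
Proof. by move=> st; apply: Fm_inj; apply: rsubst_ext => u /st ->. Qed.

Lemma subst_id_alpha s f :
  (forall u, occ f u -> s u = vsubst fVar u) -> alpha (subst s f) f.
Proof. by move/subst_ext->; apply/alpha_sym/alpha_id. Qed.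

Lemma subst_subst1 s f x g :
  subst s (subst1 f x g) = subst (updS s x (subst s g)) f.
Proof.
rewrite /subst1 subst_comp; apply: subst_ext => -[z|c] _ /=; last exact: Fm_inj.
by rewrite /upd; case: eqP => // _; exact: Fm_inj.
Qed.

(** As [y] is fresh, the outer substitution fixes the free variables of every other image [s u]; it
    may still rename bound variables there, whence alpha-congruence instead of equality. *)
Lemma subst1_updS s f x y g :
  (forall u, occ f u -> u <> inl x -> y \notin rfvar (s u)) ->
  alpha (subst1 (subst (updS s x (fVar y)) f) y g) (subst (updS s x g) f).
Proof.
move=> yf; rewrite /subst1 subst_comp; apply: alpha_subst_ext => u uf.
have aux : u <> inl x ->
    alpha (subst (vsubst (upd fVar y g)) (s u)) (s u).
  move=> ux; apply: subst_id_alpha => -[v|//] vs /=; rewrite /upd.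
  by case: eqP => // vy; move: (yf u uf ux); rewrite -vy; move: vs => /= ->.
case: u uf aux => [z|c] uf aux /=; last exact: aux.
case: eqP => [zx|zx]; last by apply: aux => -[].
by apply: alpha_eq; rewrite /= /upd eqxx.
Qed.

Lemma mem_fvar_updS s f x y :
  x \in fvar f -> y \in fvar (subst (updS s x (fVar y)) f).
Proof. by move=> xf; apply: (rfvar_rsubst xf); rewrite /= eqxx mem_head. Qed.

(** Any fresh [y] may serve as bound variable, not just the one [subst] picks; thus several
    quantifiers of one axiom can share a variable. *)
Lemma alpha_subst_all s f x y hx (hy : y \in fvar (subst (updS s x (fVar y)) f)) :
  (forall u, occ f u -> u <> inl x -> y \notin rfvar (s u)) ->
  alpha (subst s (fAll x f hx)) (fAll y (subst (updS s x (fVar y)) f) hy).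
Proof.
move=> yf; apply: alphaP.
rewrite [fraw (subst _ (fAll _ _ _))]/= -/(rsubst _ (RAll x f)) rsubst_comp.
rewrite -(@rsubst_all_comp _ x y (fun u => s u)).
- congr (rsubst _ (RAll y _)); apply: rsubst_ext => u _.
  by rewrite updS_rupd.
- by move=> *; exact: rsubst_comp.
by move=> u /occ_all[uf ux]; exact: yf.
Qed.

End AlphaCongruence.

(** * Closure properties of axioms and derivations *)

Section Deduction.
Variables (C : Type) (top bot : C).
Implicit Types (f g h : Fm C) (s : V + C -> Fm C) (Phi Psi : Fm C -> Prop).
Local Notation AX := (AX top bot).
Local Notation derives := (derives top bot).

(** A quantified axiom goes to the axiom of the same shape over a fresh variable, which differs from
    the substituted one only in bound variables. Fixing [top] and [bot] keeps instances of
    tautologies of that form. *)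
Lemma AX_subst s f :
  s (inr top) = fCon top -> s (inr bot) = fCon bot -> AX f ->
  exists2 f', AX f' & alpha f' (subst s f).
Proof.
move=> s1 s0 axf; elim: axf s s1 s0 => {f}.
- move=> p t tp s s1 s0; exists (subst (vsubst (fun x => subst s (t x))) (pembed top bot p)).
    exact: ax_taut.
  apply: alpha_eq; congr fraw; elim: p {tp} => [x|||p IHp|p IHp q IHq|p IHp q IHq|p IHp q IHq];
    apply: Fm_inj => //=.
  + by rewrite s1.
  + by rewrite s0.
  + by move: (congr1 (@fraw C) IHp) => /= ->.
  1-3: by move: (congr1 (@fraw C) IHp) (congr1 (@fraw C) IHq) => /= -> ->.
- by move=> f s s1 s0; exists (fImp (fBox (subst s f)) (subst s f));
    [exact: ax_T|exact: alpha_eq].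
- by move=> f g s s1 s0; eexists;
    [exact: (ax_K top bot (subst s f) (subst s g))|exact: alpha_eq].
- by move=> f g s s1 s0; eexists;
    [exact: (ax_S3 top bot (subst s f) (subst s g))|exact: alpha_eq].
- move=> f g fg s s1 s0; exists (fEqv (subst s f) (subst s g)); last exact: alpha_eq.
  by apply: ax_alpha; apply: alpha_eq; exact: alpha_rsubst.
- by move=> f g s s1 s0; eexists;
    [exact: (ax_eqv_imp top bot (subst s f) (subst s g))|exact: alpha_eq].
- move=> f g g' x xf s s1 s0; set y := rfresh (fun u => s u) (RAll x f).
  have yf u : occ f u -> u <> inl x -> y \notin rfvar (s u).
    by move=> uf ux; apply: (@rfreshP C (fun u => s u)); apply/occ_all.
  exists (fImp (fEqv (subst s g) (subst s g'))
    (fEqv (subst1 (subst (updS s x (fVar y)) f) y (subst s g))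
          (subst1 (subst (updS s x (fVar y)) f) y (subst s g')))).
    by apply: ax_eqv_subst; exact: mem_fvar_updS.
  have alphag h : alpha (subst1 (subst (updS s x (fVar y)) f) y (subst s h))
      (subst s (subst1 f x h)) by rewrite subst_subst1; exact: subst1_updS.
  by apply: alpha_trans (alpha_imp (alpha_refl _)
    (alpha_eqv (alphag g) (alphag g'))) _; exact: alpha_eq.
- move=> x f g xf s s1 s0; set y := rfresh (fun u => s u) (RAll x f).
  have yf u : occ f u -> u <> inl x -> y \notin rfvar (s u).
    by move=> uf ux; apply: (@rfreshP C (fun u => s u)); apply/occ_all.
  have hy := mem_fvar_updS s y xf.
  eexists; first exact: (ax_inst top bot (subst s g) hy).
  apply: alpha_trans (_ : alpha (fImp (subst s (fAll x f xf)) (subst s (subst1 f x g))) _);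
    last exact: alpha_eq.
  apply: alpha_imp; first by apply: alpha_sym; exact: alpha_subst_all.
  by rewrite subst_subst1; exact: subst1_updS.
(* One [y] fresh for the whole implication serves all three quantifiers. *)
- move=> x f g h hf hg s s1 s0; set y := rfresh (fun u => s u) (RAll x (fImp f g)).
  have yfg u : occ (fImp f g) u -> u <> inl x -> y \notin rfvar (s u).
    by move=> uf ux; apply: (@rfreshP C (fun u => s u)); apply/occ_all.
  have yf u : occ f u -> u <> inl x -> y \notin rfvar (s u).
    by move=> uf; apply: yfg; apply/occ_imp; left.
  have yg u : occ g u -> u <> inl x -> y \notin rfvar (s u).
    by move=> ug; apply: yfg; apply/occ_imp; right.
  eexists; first exact: (ax_all_imp top bot (mem_fvar_updS s y h :
    y \in fvar (fImp (subst (updS s x (fVar y)) f) (subst (updS s x (fVar y)) g)))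
    (mem_fvar_updS s y hf) (mem_fvar_updS s y hg)).
  apply: alpha_trans (_ : alpha (fImp (subst s (fAll x (fImp f g) h))
    (fImp (subst s (fAll x f hf)) (subst s (fAll x g hg)))) _); last exact: alpha_eq.
  apply: alpha_sym; apply: alpha_imp; last by apply: alpha_imp; exact: alpha_subst_all.
  by apply: alpha_trans (alpha_subst_all h (mem_fvar_updS s y h) yfg) _; exact: alpha_eq.
- move=> x f g h hg xf s s1 s0; set y := rfresh (fun u => s u) (RAll x (fImp f g)).
  have yfg u : occ (fImp f g) u -> u <> inl x -> y \notin rfvar (s u).
    by move=> uf ux; apply: (@rfreshP C (fun u => s u)); apply/occ_all.
  have xfu u : occ f u -> u <> inl x by move=> uf ux; move: xf uf; rewrite ux /= => /negP.
  have yg u : occ g u -> u <> inl x -> y \notin rfvar (s u).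
    by move=> ug; apply: yfg; apply/occ_imp; right.
  (* Since [x] is not free in [f], the update at [x] does not affect the antecedent, which can stay
     outside the quantifier. *)
  have sf : subst (updS s x (fVar y)) f = subst s f.
    by apply: subst_ext => -[z|//] /xfu zx /=; case: eqP => // zx'; case: zx; rewrite zx'.
  have yf : y \notin fvar (subst s f).
    apply/negP => /(occ_rsubst (fun u => s u) f (inl y)) [u uf].
    by apply/negP/yfg; [apply/occ_imp; left|exact: xfu].
  have hy : y \in fvar (fImp (subst s f) (subst (updS s x (fVar y)) g)).
    by rewrite -{1}sf; exact: (mem_fvar_updS s y h).
  eexists; first exact: (ax_all_imp_r top bot hy (mem_fvar_updS s y hg) yf).
  apply: alpha_trans (_ : alpha (fImp (subst s (fAll x (fImp f g) h))
    (fImp (subst s f) (subst s (fAll x g hg)))) _); last exact: alpha_eq.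
  apply: alpha_sym; apply: alpha_imp.
    apply: alpha_trans (alpha_subst_all h (mem_fvar_updS s y h) yfg) _.
    by apply: alpha_eq; move: (congr1 (@fraw C) sf) => /= ->.
  by apply: alpha_imp; [exact: alpha_refl|exact: alpha_subst_all].
- move=> x f h h' s s1 s0; set y := rfresh (fun u => s u) (RAll x f).
  have yf u : occ f u -> u <> inl x -> y \notin rfvar (s u).
    by move=> uf ux; apply: (@rfreshP C (fun u => s u)); apply/occ_all.
  eexists; first exact: (ax_box_all top bot (mem_fvar_updS s y h)
    (mem_fvar_updS s y h' : y \in fvar (fBox (subst (updS s x (fVar y)) f)))).
  apply: alpha_trans (_ : alpha (fImp (fBox (subst s (fAll x f h)))
    (subst s (fAll x (fBox f) h'))) _); last exact: alpha_eq.
  apply: alpha_sym; apply: alpha_imp; first by apply/alpha_box/alpha_subst_all.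
  apply: alpha_trans (alpha_subst_all h' (mem_fvar_updS s y h') yf) _.
  exact: alpha_eq.
move=> x f h _ IH s s1 s0; set y := rfresh (fun u => s u) (RAll x f).
have yf u : occ f u -> u <> inl x -> y \notin rfvar (s u).
  by move=> uf ux; apply: (@rfreshP C (fun u => s u)); apply/occ_all.
(* The induction hypothesis is taken at [s] with [x] sent to [y], so that generalizing over [y]
   gives the substituted quantifier. *)
have [f' axf' ff'] := IH (updS s x (fVar y)) s1 s0.
have hy' : y \in fvar f'.
  by have /(iffRL (alpha_occ (inl y) ff')) := mem_fvar_updS s y h.
exists (fAll y f' hy'); first exact: ax_gen.
apply: alpha_trans (alpha_all hy' (mem_fvar_updS s y h) ff') _.
by apply/alpha_sym/alpha_subst_all.
Qed.

(** [l] lists the formulas put for the propositional variables, with [fCon top] beyond its end.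
    Comparing raw formulas lets each use be checked by computation. *)
Lemma derives_taut (p : pform) (l : seq (Fm C)) Phi f :
  tautology p ->
  fraw f = subst (vsubst (nth (fCon top) l)) (pembed top bot p) ->
  derives Phi f.
Proof. by move=> tp /Fm_inj ->; apply: der_ax; exact: ax_taut. Qed.

Lemma derives_weaken Phi Psi f :
  (forall g, Phi g -> Psi g) -> derives Phi f -> derives Psi f.
Proof.
move=> PP; elim=> {f}; [|by move=> f ?; exact: der_ax| |by move=> f ?; exact: der_nec].
  by move=> f /PP; exact: der_hyp.
by move=> f g _ df _; exact: der_mp.
Qed.

Lemma derives_cut Phi Psi f :
  (forall g, Phi g -> derives Psi g) -> derives Phi f -> derives Psi f.
Proof.
move=> PP; elim=> {f}; [|by move=> f ?; exact: der_ax| |by move=> f ?; exact: der_nec].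
  by move=> f /PP.
by move=> f g _ df _; exact: der_mp.
Qed.

Lemma derives_alpha Phi f g : alpha f g -> derives Phi f -> derives Phi g.
Proof.
move=> fg df; apply: (der_mp df); apply: der_mp (der_ax _ (ax_eqv_imp top bot f g)).
exact/der_ax/ax_alpha.
Qed.

(** Necessitation applies to axioms alone, so a necessitated formula never depends on [f] and the
    deduction theorem holds without restriction. *)
Lemma derives_imp Phi f g :
  derives (fun h => Phi h \/ h = f) g -> derives Phi (fImp f g).
Proof.
have K a b : derives Phi a -> derives Phi (fImp b a).
  move=> da; apply: (der_mp da).
  by apply: (@derives_taut (PImp (PVar 0) (PImp (PVar 1) (PVar 0))) [:: a; b]) => // v /=;
    case: (v 0); case: (v 1).
elim=> {g} [g [Pg|->]|g axg|a b _ IHa _ IHb|g axg].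
- exact/K/der_hyp.
- by apply: (@derives_taut (PImp (PVar 0) (PVar 0)) [:: f]) => // v /=; case: (v 0).
- exact/K/der_ax.
- apply: (der_mp IHa); apply: (der_mp IHb).
  by apply: (@derives_taut (PImp (PImp (PVar 0) (PImp (PVar 1) (PVar 2)))
    (PImp (PImp (PVar 0) (PVar 1)) (PImp (PVar 0) (PVar 2)))) [:: f; a; b]) => // v /=;
    case: (v 0); case: (v 1); case: (v 2).
- exact/K/der_nec.
Qed.

Lemma derives_finite Phi f : derives Phi f ->
  exists2 l : seq (Fm C), (forall g, List.In g l -> Phi g) &
    derives (fun g => List.In g l) f.
Proof.
elim=> {f} [f Pf|f axf|a b _ [l lP la] _ [l' lP' lb]|f axf].
- exists [:: f]; first by move=> g [<-|].
  by apply: der_hyp; left.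
- by exists [::] => //; exact: der_ax.
- exists (l ++ l'); first by move=> g /In_cat[/lP|/lP'].
  by apply: der_mp; [apply: derives_weaken la|apply: derives_weaken lb] => g gl;
    apply/In_cat; [left|right].
- by exists [::] => //; exact: der_nec.
Qed.

Lemma derives_subst s Phi f :
  s (inr top) = fCon top -> s (inr bot) = fCon bot -> derives Phi f ->
  derives (fun g => exists2 h, Phi h & g = subst s h) (subst s f).
Proof.
move=> s1 s0; elim=> {f} [f Pf|f axf|a b _ IHa _ IHb|f axf].
- by apply: der_hyp; exists f.
- have [f' axf' ff'] := AX_subst s1 s0 axf.
  by apply: (derives_alpha ff'); exact: der_ax.
- by apply: (der_mp IHa); apply: derives_alpha IHb; exact: alpha_eq.
have [f' axf' ff'] := AX_subst s1 s0 axf.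
apply: (@derives_alpha _ (fBox f')); last exact: der_nec.
by apply: alpha_trans (alpha_box ff') _; exact: alpha_eq.
Qed.

(** Derivations have no generalization rule, so it is recovered by induction: axioms are closed
    under it, the distribution axioms carry it through modus ponens, and a necessitated axiom is
    generalized inside the box first. *)
Lemma derives_gen Phi y f (hy : y \in fvar f) :
  (forall g, Phi g -> y \notin fvar g) -> derives Phi f ->
  derives Phi (fAll y f hy).
Proof.
move=> yP df; elim: df hy => {f} [f /yP/negP//|f axf hy|a b da IHa db IHb hy|f axf hy].
- exact/der_ax/ax_gen.
- have hab : y \in fvar (fImp a b) by rewrite /fvar /= mem_cat hy orbT.
  (* Quantifying [a] gives a formula only if [y] is free in [a]; otherwise [a] stays as an
     unquantified antecedent. *)
  case: (boolP (y \in fvar a)) => [ha|na].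
    by apply: der_mp (IHa ha) (der_mp (IHb hab) _); apply/der_ax/ax_all_imp.
  by apply: der_mp da (der_mp (IHb hab) _); apply/der_ax/ax_all_imp_r.
have hf : y \in fvar f by [].
apply: der_mp (der_ax _ (ax_box_all top bot hf hy)).
exact/der_nec/ax_gen.
Qed.

(** A constant absent from [Phi] and [f] behaves like a variable: it is replaced by a fresh [y]
    throughout a derivation, [y] is generalized and then renamed to [x]. The substitution has to fix
    [top] and [bot], so [c] differs from both. *)
Lemma derives_gen_con Phi x f (hx : x \in fvar f) c :
  c <> top -> c <> bot -> ~ occ f (inr c) -> (forall g, Phi g -> ~ occ g (inr c)) ->
  derives Phi (subst1 f x (fCon c)) -> derives Phi (fAll x f hx).
Proof.
move=> c1 c0 cf cP /derives_finite [l lP dl].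
(* Only finitely many premises are used, so [y] can exceed all their free variables and those of the
   conclusion. *)
pose y := \max_(g <- fAll x f hx :: l) rbound g.
have yfresh g : List.In g (fAll x f hx :: l) -> y \notin fvar g.
  move=> gl; apply/negP => /rbound_gt yg.
  have gy : rbound g <= y by move: g gl {yg}; apply/bigmax_In_leP.
  by move: (leq_trans yg gy); rewrite ltnn.
pose s (u : V + C) : Fm C := match u with
  | inl z => fVar z | inr d => if pselect (d = c) then fVar y else fCon d end.
have sid g : ~ occ g (inr c) -> alpha (subst s g) g.
  move=> cg; apply: subst_id_alpha => -[//|d] dg /=.
  by case: pselect => // dc; case: cg; rewrite -dc.
have s1 : s (inr top) = fCon top.
  by rewrite /s; case: pselect => // e; case: c1; rewrite -e.
have s0 : s (inr bot) = fCon bot.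
  by rewrite /s; case: pselect => // e; case: c0; rewrite -e.
have {}dl : derives (fun g => List.In g l) (subst1 f x (fVar y)).
  have := derives_subst s1 s0 dl; rewrite subst_subst1 => dl'.
  apply: (@derives_cut (fun g => exists2 h, List.In h l & g = subst s h)); last first.
    apply: derives_alpha dl'; apply: alpha_subst_ext => -[z|d] uf /=; last first.
      by case: pselect => [dc|dc]; [case: cf; rewrite -dc|exact: alpha_refl].
    rewrite /upd; case: eqP => _; last exact: alpha_refl.
    by apply: alpha_eq => /=; case: pselect.
  (* The premises avoid [c], so replacing it alters them only up to alpha-congruence. *)
  move=> g [h hl ->]; apply: (@derives_alpha _ h); last exact: der_hyp.
  by apply/alpha_sym/sid/cP/lP.
apply: (derives_weaken lP).
have hy : y \in fvar (subst1 f x (fVar y)).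
  by apply: (rfvar_rsubst hx); rewrite /= /upd eqxx mem_head.
apply: (@derives_alpha _ (fAll y _ hy)).
  by apply: alpha_sym; apply: alpha_rename; apply: yfresh; left.
by apply: derives_gen => // g gl; apply: yfresh; right.
Qed.

End Deduction.

(** * Translation of formulas, derivations and models along a map of constants *)

Section ConstantMap.
Variables (C D : Type) (r : C -> D).

(** [r] is arbitrary, since the same construction both embeds a language into the enlarged one and
    later collapses the witnesses. *)
Fixpoint rmap (f : raw C) : raw D :=
  match f with
  | RVar x => RVar x
  | RCon c => RCon (r c)
  | RNot g => RNot (rmap g)
  | RBox g => RBox (rmap g)
  | RImp g h => RImp (rmap g) (rmap h)
  | ROr g h => ROr (rmap g) (rmap h)
  | RAnd g h => RAnd (rmap g) (rmap h)
  | REqv g h => REqv (rmap g) (rmap h)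
  | RAll x g => RAll x (rmap g)
  end.

Lemma rfvar_rmap f : rfvar (rmap f) = rfvar f.
Proof. by elim: f => //= [g -> h ->|g -> h ->|g -> h ->|g -> h ->|x g ->]. Qed.

Lemma rcon_rmap f : rcon (rmap f) = map r (rcon f).
Proof.
by elim: f => //= [g -> h ->|g -> h ->|g -> h ->|g -> h ->]; rewrite map_cat.
Qed.

Lemma wf_rmap f : wf f -> wf (rmap f).
Proof.
elim: f => //= [g IHg h IHh|g IHg h IHh|g IHg h IHh|g IHg h IHh|x g IHg].
1-4: by move=> /andP[/IHg -> /IHh ->].
by rewrite rfvar_rmap => /andP[-> /IHg ->].
Qed.

(** Bound variables are chosen from the free variables of the images, and [rmap] preserves these, so
    both sides choose the same ones. *)
Lemma rmap_rsubst (s : V + C -> raw C) (t : V + D -> raw D) f :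
  (forall x, t (inl x) = rmap (s (inl x))) ->
  (forall c, t (inr (r c)) = rmap (s (inr c))) ->
  rmap (rsubst s f) = rsubst t (rmap f).
Proof.
elim: f s t => [x|c|g IHg|g IHg|g IHg h IHh|g IHg h IHh|g IHg h IHh
  |g IHg h IHh|x g IHg] s t st1 st2 /=; rewrite ?st1 ?st2 //.
1,2: by rewrite (IHg s t).
1-4: by rewrite (IHg s t) ?(IHh s t).
have -> : rfresh s (RAll x g) = rfresh t (RAll x (rmap g)).
  rewrite /rfresh /= rfvar_rmap rcon_rmap big_map.
  by congr maxn; apply: eq_bigr => u _; rewrite ?st1 ?st2 /rbound rfvar_rmap.
congr (RAll _ _); apply: IHg => [z|c] /=; last exact: st2.
by case: eqP => // _; exact: st1.
Qed.

Definition fmap (f : Fm C) : Fm D := MkFm (wf_rmap (fwf f)).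

Lemma fvar_fmap f : fvar (fmap f) = fvar f.
Proof. exact: rfvar_rmap. Qed.

Lemma fmap_vsubst (s : V -> Fm C) f :
  fmap (subst (vsubst s) f) = subst (vsubst (fun x => fmap (s x))) (fmap f).
Proof. by apply: Fm_inj; apply: rmap_rsubst. Qed.

Lemma fmap_subst1 f x g : fmap (subst1 f x g) = subst1 (fmap f) x (fmap g).
Proof.
rewrite /subst1 fmap_vsubst; apply: subst_ext => -[z|//] _ /=.
by rewrite /upd; case: eqP => // _; exact: Fm_inj.
Qed.

Lemma fmap_all x f h (h' : x \in fvar (fmap f)) :
  fmap (fAll x f h) = fAll x (fmap f) h'.
Proof. exact: Fm_inj. Qed.

Lemma alpha_fmap f g : alpha f g -> alpha (fmap f) (fmap g).
Proof.
move=> fg; apply: alphaP; move/(alpha_rsubst (@idS C))/(congr1 rmap): fg.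
by rewrite !(@rmap_rsubst _ (@idS D)).
Qed.

Variables (top bot : C).

Lemma AX_fmap f : AX top bot f -> AX (r top) (r bot) (fmap f).
Proof.
have mem x g : x \in fvar g -> x \in fvar (fmap g) by rewrite fvar_fmap.
elim=> {f}.
- move=> p s tp; rewrite fmap_vsubst.
  have -> : fmap (pembed top bot p) = pembed (r top) (r bot) p.
    by elim: p {tp} => [x|||p IHp|p IHp q IHq|p IHp q IHq|p IHp q IHq];
      rewrite /= -?IHp -?IHq; exact: Fm_inj.
  exact: ax_taut.
- move=> f; rewrite (_ : fmap _ = fImp (fBox (fmap f)) (fmap f)); last exact: Fm_inj.
  exact: ax_T.
- move=> f g; have := ax_K (r top) (r bot) (fmap f) (fmap g).
  by congr AX; exact: Fm_inj.
- move=> f g; have := ax_S3 (r top) (r bot) (fmap f) (fmap g).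
  by congr AX; exact: Fm_inj.
- move=> f g /alpha_fmap/(ax_alpha (r top) (r bot)).
  by congr AX; exact: Fm_inj.
- move=> f g; have := ax_eqv_imp (r top) (r bot) (fmap f) (fmap g).
  by congr AX; exact: Fm_inj.
- move=> f g g' x /mem/(ax_eqv_subst (r top) (r bot) (fmap g) (fmap g')).
  by rewrite -!fmap_subst1; congr AX; exact: Fm_inj.
- move=> x f g h; have := ax_inst (r top) (r bot) (fmap g) (mem _ _ h).
  by rewrite -fmap_subst1; congr AX; exact: Fm_inj.
- move=> x f g h hf hg.
  have := @ax_all_imp D (r top) (r bot) x (fmap f) (fmap g)
    (mem _ _ h) (mem _ _ hf) (mem _ _ hg).
  by congr AX; exact: Fm_inj.
- move=> x f g h hg xf.
  have := @ax_all_imp_r D (r top) (r bot) x (fmap f) (fmap g) (mem _ _ h) (mem _ _ hg).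
  by rewrite fvar_fmap => /(_ xf); congr AX; exact: Fm_inj.
- move=> x f h h'.
  have := @ax_box_all D (r top) (r bot) x (fmap f) (mem _ _ h) (mem _ _ h').
  by congr AX; exact: Fm_inj.
by move=> x f h _ IH; rewrite (fmap_all h (mem _ _ h)); exact: ax_gen.
Qed.

Lemma derives_fmap (Phi : Fm C -> Prop) f :
  derives top bot Phi f ->
  derives (r top) (r bot) (fun g => exists2 h, Phi h & g = fmap h) (fmap f).
Proof.
elim=> {f} [f Pf|f axf|a b _ IHa _ IHb|f axf].
- by apply: der_hyp; exists f.
- exact/der_ax/AX_fmap.
- by apply: (der_mp IHa); move: IHb; congr derives; exact: Fm_inj.
- have := der_nec (fun g => exists2 h, Phi h & g = fmap h) (AX_fmap axf).
  by congr derives; exact: Fm_inj.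
Qed.

(** The reduct keeps carrier, truth and necessity, and evaluates a formula by its image under
    [fmap]. Assignments are matched existentially because the existential on [N] hides that the
    carriers coincide. *)
Lemma model_reduct (M : simple_model (r top) (r bot)) : admissible M ->
  exists2 N : simple_model top bot, admissible N &
  forall g : V -> carrier M, exists g' : V -> carrier N, forall f,
    satisfies g' f <-> satisfies g (fmap f).
Proof.
move=> admM.
have mem x g : x \in fvar g -> x \in fvar (fmap g) by rewrite fvar_fmap.
pose e (g : V -> carrier M) (f : Fm C) := ext g (fmap f).
have eE g f f' : fmap f = f' -> e g f = ext g f' by rewrite /e => ->.
have e_var g x : e g (fVar x) = g x.
  by rewrite (eE _ _ (fVar x)) ?ext_var //; exact: Fm_inj.
have e_con g c : e g (fCon c) = Gamma M (r c).
  by rewrite (eE _ _ (fCon (r c))) ?ext_con //; exact: Fm_inj.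
have e_coinc g g' f : (forall x : V, x \in fvar f -> g x = g' x) -> e g f = e g' f.
  by move=> gg'; apply: ext_coincidence => x; rewrite fvar_fmap; exact: gg'.
have e_subst g (s : V -> Fm C) f : e g (subst (vsubst s) f) = e (fun x => e g (s x)) f.
  by rewrite /e fmap_vsubst ext_subst.
have e_imp g f h : e g (fImp f h) = ext g (fImp (fmap f) (fmap h)).
  by apply: eE; exact: Fm_inj.
have e_not g f : e g (fNot f) = ext g (fNot (fmap f)) by apply: eE; exact: Fm_inj.
have e_and g f h : e g (fAnd f h) = ext g (fAnd (fmap f) (fmap h)).
  by apply: eE; exact: Fm_inj.
have e_or g f h : e g (fOr f h) = ext g (fOr (fmap f) (fmap h)).
  by apply: eE; exact: Fm_inj.
have e_box g f : e g (fBox f) = ext g (fBox (fmap f)) by apply: eE; exact: Fm_inj.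
have e_eqv g f h : e g (fEqv f h) = ext g (fEqv (fmap f) (fmap h)).
  by apply: eE; exact: Fm_inj.
have e_all g x f hx : e g (fAll x f hx) = ext g (fAll x (fmap f) (mem _ _ hx)).
  by apply: eE; exact: Fm_inj.
have t_imp g f h : TRUE (e g (fImp f h)) <-> (~ TRUE (e g f) \/ TRUE (e g h)).
  by rewrite e_imp true_imp.
have t_not g f : TRUE (e g (fNot f)) <-> ~ TRUE (e g f) by rewrite e_not true_not.
have t_and g f h : TRUE (e g (fAnd f h)) <-> (TRUE (e g f) /\ TRUE (e g h)).
  by rewrite e_and true_and.
have t_or g f h : TRUE (e g (fOr f h)) <-> (TRUE (e g f) \/ TRUE (e g h)).
  by rewrite e_or true_or.
have t_box g f : TRUE (e g (fBox f)) <-> NEC (e g f) by rewrite e_box true_box.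
have t_eqv g f h : TRUE (e g (fEqv f h)) <-> e g f = e g h by rewrite e_eqv true_eqv.
have t_all g (x : V) f (hx : x \in fvar f) :
    TRUE (e g (fAll x f hx)) <-> forall a, TRUE (e (upd g x a) f).
  by rewrite e_all true_all.
have n_imp g f h : NEC (e g (fImp f h)) -> NEC (e g (fImp (fBox f) (fBox h))).
  rewrite e_imp => nf; move: (nec_imp nf); congr NEC; rewrite (eE _ _ _ erefl).
  by congr ext; exact: Fm_inj.
have n_all g (x : V) f (hx : x \in fvar f) :
    NEC (e g (fAll x f hx)) -> forall a, NEC (e (upd g x a) f).
  by rewrite e_all => nf a; exact: nec_all nf a.
exists (@SimpleModel C top bot (carrier M) (@TRUE _ _ _ M) (@NEC _ _ _ M)
  (fun c => Gamma M (r c)) e (carrier_inhabited M) (@NEC_TRUE _ _ _ M)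
  e_var e_con e_coinc e_subst (@true_bot _ _ _ M) (@true_top _ _ _ M)
  t_imp t_not t_and t_or t_box t_eqv t_all n_imp n_all).
  by move=> g f /AX_fmap axf; exact: admM.
by move=> g; exists g.
Qed.

End ConstantMap.

(** * The canonical model of a maximal theory with witnesses *)

Section CanonicalModel.
Variables (C : Type) (top bot : C) (T : Fm C -> Prop).
Hypothesis T_closed : forall f, derives top bot T f -> T f.
Hypothesis T_not : forall f, T (fNot f) <-> ~ T f.
Hypothesis T_wit : forall x f (hx : x \in fvar f),
  exists c, T (subst1 f x (fCon c)) -> T (fAll x f hx).
Implicit Types (f h : Fm C) (s t : V -> Fm C).

Lemma T_mp f g : T f -> T (fImp f g) -> T g.
Proof.
move=> Tf Tfg; apply: T_closed.
exact: der_mp (der_hyp _ _ Tf) (der_hyp _ _ Tfg).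
Qed.

Lemma T_ax f : AX top bot f -> T f.
Proof. by move=> axf; apply/T_closed/der_ax. Qed.

Lemma T_alpha f g : alpha f g -> T f <-> T g.
Proof.
move=> fg; split=> Tf; apply: T_closed.
  exact: derives_alpha fg (der_hyp _ _ Tf).
exact: derives_alpha (alpha_sym fg) (der_hyp _ _ Tf).
Qed.

Lemma T_taut (p : pform) (l : seq (Fm C)) f :
  tautology p ->
  fraw f = subst (vsubst (nth (fCon top) l)) (pembed top bot p) -> T f.
Proof. by move=> tp fE; apply: T_closed; exact: derives_taut tp fE. Qed.

Lemma T_imp f g : T (fImp f g) <-> ~ T f \/ T g.
Proof.
split=> [Tfg|[/T_not Tf|Tg]].
- by have [Tf|Tf] := pselect (T f); [right; exact: T_mp Tf Tfg|left].
- apply: (T_mp Tf).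
  by apply: (@T_taut (PImp (PNot (PVar 0)) (PImp (PVar 0) (PVar 1))) [:: f; g]) => // v /=;
    case: (v 0); case: (v 1).
- apply: (T_mp Tg).
  by apply: (@T_taut (PImp (PVar 1) (PImp (PVar 0) (PVar 1))) [:: f; g]) => // v /=;
    case: (v 0); case: (v 1).
Qed.

Lemma T_and f g : T (fAnd f g) <-> T f /\ T g.
Proof.
split=> [Tfg|[Tf Tg]]; last first.
  apply: (T_mp Tg); apply: (T_mp Tf).
  by apply: (@T_taut (PImp (PVar 0) (PImp (PVar 1) (PAnd (PVar 0) (PVar 1)))) [:: f; g]) =>
    // v /=; case: (v 0); case: (v 1).
split; apply: (T_mp Tfg).
  by apply: (@T_taut (PImp (PAnd (PVar 0) (PVar 1)) (PVar 0)) [:: f; g]) =>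
    // v /=; case: (v 0); case: (v 1).
by apply: (@T_taut (PImp (PAnd (PVar 0) (PVar 1)) (PVar 1)) [:: f; g]) =>
  // v /=; case: (v 0); case: (v 1).
Qed.

Lemma T_or f g : T (fOr f g) <-> T f \/ T g.
Proof.
split=> [Tfg|[Tf|Tg]].
- have [Tf|/T_not Tf] := pselect (T f); [by left|right].
  apply: (T_mp Tf); apply: (T_mp Tfg).
  by apply: (@T_taut (PImp (POr (PVar 0) (PVar 1)) (PImp (PNot (PVar 0)) (PVar 1)))
    [:: f; g]) => // v /=; case: (v 0); case: (v 1).
- apply: (T_mp Tf).
  by apply: (@T_taut (PImp (PVar 0) (POr (PVar 0) (PVar 1))) [:: f; g]) =>
    // v /=; case: (v 0); case: (v 1).
- apply: (T_mp Tg).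
  by apply: (@T_taut (PImp (PVar 1) (POr (PVar 0) (PVar 1))) [:: f; g]) =>
    // v /=; case: (v 0); case: (v 1).
Qed.

Lemma T_bot : ~ T (fCon bot).
Proof. by apply/T_not; exact: (@T_taut (PNot PBot) [::]). Qed.

Lemma T_top : T (fCon top).
Proof. exact: (@T_taut PTop [::]). Qed.

Definition Teqv f g : Prop := T (fEqv f g).

Lemma Teqv_alpha f g : alpha f g -> Teqv f g.
Proof. by move=> fg; apply/T_ax/ax_alpha. Qed.

Lemma Teqv_T f g : Teqv f g -> T f -> T g.
Proof. by move=> fg Tf; apply: (T_mp Tf); apply: (T_mp fg); exact/T_ax/ax_eqv_imp. Qed.

(** The substitution axiom requires [x] free in [f]; otherwise both sides are alpha-congruent. *)
Lemma Teqv_subst1 f x g g' : Teqv g g' -> Teqv (subst1 f x g) (subst1 f x g').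
Proof.
move=> gg'; case: (boolP (x \in fvar f)) => xf.
  by apply: (T_mp gg'); exact/T_ax/ax_eqv_subst.
apply: Teqv_alpha; apply: alpha_subst_ext => -[z|c] /= zf; last exact: alpha_refl.
rewrite /upd; case: eqP => [zx|_]; last exact: alpha_refl.
by move: xf; rewrite -zx /fvar zf.
Qed.

Lemma Teqv_refl f : Teqv f f.
Proof. exact/Teqv_alpha/alpha_refl. Qed.

Lemma subst1_fresh f x g : x \notin fvar f -> alpha (subst1 f x g) f.
Proof.
move=> xf; apply: subst_id_alpha => -[z|//] zf /=; rewrite /upd.
by case: eqP => // zx; move: xf; rewrite -zx /fvar; move: zf => /= ->.
Qed.

(** Symmetry is not among the axioms; it comes from replacing [f] by [g] on the left of the
    reflexive identity of [f], a place marked by a fresh variable. *)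
Lemma Teqv_sym f g : Teqv f g -> Teqv g f.
Proof.
move=> fg; pose x := rbound f.
have xf : x \notin fvar f by apply/negP => /rbound_gt; rewrite ltnn.
have E h : alpha (subst1 (fEqv (fVar x) f) x h) (fEqv h f).
  apply: alpha_trans (alpha_eqv (alpha_refl h) (subst1_fresh h xf)).
  by apply: alpha_eq => /=; rewrite /upd eqxx.
have := Teqv_T (Teqv_subst1 (fEqv (fVar x) f) x fg).
by rewrite !(T_alpha (E _)); apply; exact: Teqv_refl.
Qed.

Lemma Teqv_trans f g h : Teqv f g -> Teqv g h -> Teqv f h.
Proof.
move=> fg gh; pose x := rbound f.
have xf : x \notin fvar f by apply/negP => /rbound_gt; rewrite ltnn.
have E k : alpha (subst1 (fEqv f (fVar x)) x k) (fEqv f k).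
  apply: alpha_trans (alpha_eqv (subst1_fresh k xf) (alpha_refl k)).
  by apply: alpha_eq => /=; rewrite /upd eqxx.
have := Teqv_T (Teqv_subst1 (fEqv f (fVar x)) x gh).
by rewrite !(T_alpha (E _)); apply.
Qed.

Lemma Teqv_T_iff f g : Teqv f g -> T f <-> T g.
Proof. by move=> fg; split; apply: Teqv_T => //; exact: Teqv_sym. Qed.

Lemma Teqv_box f g : Teqv f g -> Teqv (fBox f) (fBox g).
Proof.
move=> fg; have /T_alpha := Teqv_subst1 (fBox (fVar 0)) 0 fg.
by move=> /(_ _ (alpha_eq _)) //; apply.
Qed.

Lemma updS_vsubst s x g u : updS (vsubst s) x g u = vsubst (upd s x g) u.
Proof. by case: u => //= z; rewrite /upd; case: eqP. Qed.

Lemma subst1_upd s x f g (y := rfresh (fun u => vsubst s u) (RAll x f)) :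
  alpha (subst1 (subst (updS (vsubst s) x (fVar y)) f) y g)
        (subst (vsubst (upd s x g)) f).
Proof.
have -> : subst (vsubst (upd s x g)) f = subst (updS (vsubst s) x g) f.
  by apply: subst_ext => u _; rewrite updS_vsubst.
apply: subst1_updS => u uf ux.
by apply: (@rfreshP C (fun u => vsubst s u)); apply/occ_all.
Qed.

Lemma Teqv_subst_upd f s x g g' : Teqv g g' ->
  Teqv (subst (vsubst (upd s x g)) f) (subst (vsubst (upd s x g')) f).
Proof.
move=> gg'; apply: Teqv_trans (Teqv_alpha (alpha_sym (subst1_upd s x f g))) _.
by apply: Teqv_trans (Teqv_alpha (subst1_upd s x f g')); exact: Teqv_subst1.
Qed.

Lemma Teqv_subst f s t : (forall x, Teqv (s x) (t x)) ->
  Teqv (subst (vsubst s) f) (subst (vsubst t) f).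
Proof.
(* [st_ n] has switched from [s] to [t] below [n]; each step changes a single variable, and
   [rbound f] steps reach all free variables of [f]. *)
move=> st; pose st_ n x := if x < n then t x else s x.
have step n : Teqv (subst (vsubst s) f) (subst (vsubst (st_ n)) f).
  elim: n => [|n IH]; first exact: Teqv_refl.
  apply: (Teqv_trans IH).
  have E : st_ n = upd (st_ n) n (s n).
    by apply/funext => x; rewrite /upd /st_; case: eqP => // ->; rewrite ltnn.
  have -> : st_ n.+1 = upd (st_ n) n (t n).
    by apply/funext => x; rewrite /upd /st_ ltnS leq_eqVlt; case: eqP => // ->.
  by rewrite {1}E; exact: Teqv_subst_upd.
apply: Teqv_trans (step (rbound f)) _; apply: Teqv_alpha.
apply: alpha_subst_ext => -[x|c] xf /=; last exact: alpha_refl.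
by rewrite /st_ (rbound_gt xf); exact: alpha_refl.
Qed.

(** The quotient by T-provable identity, with equivalence classes as predicates; [rep] chooses a
    member of each class. *)
Definition Tclass : Type := {p : Fm C -> Prop | exists f, p = Teqv f}.

Definition cls f : Tclass := exist _ (Teqv f) (ex_intro _ f erefl).

Definition rep (a : Tclass) : Fm C := projT1 (cid (projT2 a)).

Lemma cls_eq f g : cls f = cls g <-> Teqv f g.
Proof.
split=> [/(congr1 (@proj1_sig _ _)) /= ->|fg]; first exact: Teqv_refl.
apply: eq_exist => /=; apply/funext => h; apply/propext; split=> [|gh].
  exact/Teqv_trans/Teqv_sym.
exact: Teqv_trans fg gh.
Qed.

Lemma repK a : cls (rep a) = a.
Proof. by case: a => p ep; apply: eq_exist; rewrite /rep; case: cid => g /= ->. Qed.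

Lemma rep_cls f : Teqv (rep (cls f)) f.
Proof. by apply/cls_eq; rewrite repK. Qed.

Definition text (g : V -> Tclass) f : Tclass := cls (subst (vsubst (fun x => rep (g x))) f).

Definition Ttrue (a : Tclass) : Prop := T (rep a).
Definition Tnec (a : Tclass) : Prop := T (fBox (rep a)).

Lemma Ttrue_cls f : Ttrue (cls f) <-> T f.
Proof. exact/Teqv_T_iff/rep_cls. Qed.

Lemma Tnec_cls f : Tnec (cls f) <-> T (fBox f).
Proof. exact/Teqv_T_iff/Teqv_box/rep_cls. Qed.

Lemma subst_vsubst_all s x f hx :
  exists y, exists2 hy, (subst (vsubst s) (fAll x f hx) =
      fAll y (subst (updS (vsubst s) x (fVar y)) f) hy) &
    forall g, alpha (subst1 (subst (updS (vsubst s) x (fVar y)) f) y g)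
                    (subst (vsubst (upd s x g)) f).
Proof.
pose y := rfresh (fun u => vsubst s u) (RAll x f).
exists y, (mem_fvar_updS (vsubst s) y hx).
  by apply: Fm_inj => /=; congr (RAll _ _); apply: rsubst_ext => u _; rewrite updS_rupd.
by move=> g; exact: subst1_upd.
Qed.

Lemma T_inst x f (hx : x \in fvar f) g : T (fAll x f hx) -> T (subst1 f x g).
Proof. by move=> Tf; apply: (T_mp Tf); apply/T_ax/ax_inst. Qed.

Lemma text_upd (g : V -> Tclass) x a f :
  text (upd g x a) f = cls (subst (vsubst (upd (fun z => rep (g z)) x (rep a))) f).
Proof.
congr (cls (subst (vsubst _) f)); apply/funext => z.
by rewrite /upd; case: eqP.
Qed.

Theorem canonical_model : exists2 M : simple_model top bot, admissible M &
  exists g : V -> carrier M, forall f, satisfies g f <-> T f.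
Proof.
pose S (g : V -> Tclass) := subst (vsubst (fun x => rep (g x))).
have inh : inhabited Tclass by split; exact: cls (fCon top).
have N_T a : Tnec a -> Ttrue a.
  by move=> Ta; apply: (T_mp Ta); apply/T_ax/ax_T.
have e_var g x : text g (fVar x) = g x.
  by rewrite -[RHS]repK; congr cls; exact: Fm_inj.
have e_con g c : text g (fCon c) = cls (fCon c) by congr cls; exact: Fm_inj.
have e_coinc g g' f : (forall x : V, x \in fvar f -> g x = g' x) -> text g f = text g' f.
  move=> gg'; congr cls; apply: subst_ext => -[x|//] xf /=; by rewrite gg'.
have e_subst g (s : V -> Fm C) f :
    text g (subst (vsubst s) f) = text (fun x => text g (s x)) f.
  apply/cls_eq; rewrite subst_comp.
  rewrite (subst_ext (t := vsubst (fun x => subst (vsubst (fun x => rep (g x))) (s x)))).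
    (* A substituted formula and the representative of its class are identical in [T], and this
       identity is a congruence. *)
    by apply: Teqv_subst => x; apply: Teqv_sym; exact: rep_cls.
  by move=> [//|c] _ /=; exact: Fm_inj.
have t_bot : ~ Ttrue (cls (fCon bot)) by rewrite Ttrue_cls; exact: T_bot.
have t_top : Ttrue (cls (fCon top)) by rewrite Ttrue_cls; exact: T_top.
have e_imp g f h : text g (fImp f h) = cls (fImp (S g f) (S g h)).
  by congr cls; exact: Fm_inj.
have e_and g f h : text g (fAnd f h) = cls (fAnd (S g f) (S g h)).
  by congr cls; exact: Fm_inj.
have e_or g f h : text g (fOr f h) = cls (fOr (S g f) (S g h)).
  by congr cls; exact: Fm_inj.
have e_eqv g f h : text g (fEqv f h) = cls (fEqv (S g f) (S g h)).
  by congr cls; exact: Fm_inj.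
have t_imp g f h : Ttrue (text g (fImp f h)) <-> (~ Ttrue (text g f) \/ Ttrue (text g h)).
  by rewrite e_imp !Ttrue_cls T_imp.
have t_not g f : Ttrue (text g (fNot f)) <-> ~ Ttrue (text g f).
  rewrite !Ttrue_cls -T_not; apply: T_alpha; exact: alpha_eq.
have t_and g f h : Ttrue (text g (fAnd f h)) <-> (Ttrue (text g f) /\ Ttrue (text g h)).
  by rewrite e_and !Ttrue_cls T_and.
have t_or g f h : Ttrue (text g (fOr f h)) <-> (Ttrue (text g f) \/ Ttrue (text g h)).
  by rewrite e_or !Ttrue_cls T_or.
have t_box g f : Ttrue (text g (fBox f)) <-> Tnec (text g f).
  rewrite Ttrue_cls Tnec_cls; apply: T_alpha; exact: alpha_eq.
have t_eqv g f h : Ttrue (text g (fEqv f h)) <-> text g f = text g h.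
  by rewrite e_eqv Ttrue_cls /text cls_eq.
have t_all g (x : V) f (hx : x \in fvar f) :
    Ttrue (text g (fAll x f hx)) <-> forall a, Ttrue (text (upd g x a) f).
  rewrite Ttrue_cls.
  have [y [hy -> E]] := subst_vsubst_all (fun x => rep (g x)) hx.
  split=> [Tf a|Tf].
    by rewrite text_upd Ttrue_cls -(T_alpha (E _)); exact: T_inst Tf.
  (* The class of the witness is an element of the model, so truth at this element already forces
     the universal formula into [T]. *)
  have [c] := T_wit hy; apply; rewrite (T_alpha (E _)).
  move: (Tf (cls (fCon c))); rewrite text_upd Ttrue_cls; apply: Teqv_T.
  exact/Teqv_subst_upd/rep_cls.
have n_imp g f h : Tnec (text g (fImp f h)) -> Tnec (text g (fImp (fBox f) (fBox h))).
  rewrite !e_imp !Tnec_cls => Tfh.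
  have := T_mp Tfh (T_ax (ax_S3 _ _ _ _)).
  by apply: (iffLR (T_alpha (alpha_eq _))).
have n_all g (x : V) f (hx : x \in fvar f) :
    Tnec (text g (fAll x f hx)) -> forall a, Tnec (text (upd g x a) f).
  rewrite Tnec_cls; have [y [hy -> E]] := subst_vsubst_all (fun x => rep (g x)) hx.
  move=> Tf a; rewrite text_upd Tnec_cls.
  (* [ax_box_all] moves the box inward, after which the quantifier can be instantiated at the
     representative of [a]. *)
  have := T_mp Tf (T_ax (ax_box_all _ _ _ (hy : y \in fvar (fBox _)))).
  move=> /(T_inst (rep a)) Tf'; apply/(T_alpha (alpha_box (E _))).
  by move: Tf'; apply: (iffLR (T_alpha (alpha_eq _))).
exists (@SimpleModel C top bot Tclass Ttrue Tnec (fun c => cls (fCon c)) text inh N_T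
  e_var e_con e_coinc e_subst t_bot t_top
  t_imp t_not t_and t_or t_box t_eqv t_all n_imp n_all).
  move=> g f axf; apply/Tnec_cls.
  (* Substituting representatives into an axiom gives an axiom up to alpha-congruence, and
     necessitation puts its box into [T]; hence every assignment is admissible. *)
  have [//|//|f' axf' ff'] := @AX_subst _ _ _ (vsubst (fun x => rep (g x))) _ _ _ axf.
  by apply/(T_alpha (alpha_box ff')); apply/T_closed/der_nec.
(* Each variable is assigned its own class, whose representative is identical in [T] to the
   variable. *)
exists (fun x => cls (fVar x)) => f; rewrite /satisfies /= Ttrue_cls.
apply: iff_trans (iff_sym (T_alpha (alpha_id f))); apply: Teqv_T_iff.
by apply: Teqv_subst => x; exact: rep_cls.
Qed.

End CanonicalModel.

(** * Maximal consistent extensions by Zorn's lemma *)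

Section Lindenbaum.
Local Open Scope classical_set_scope.
Variables (C : Type) (top bot : C).
Local Notation derives := (derives top bot).

(** Modus ponens involves at most two members of the chain, and the larger one derives both
    premises. The first alternative covers derivations that use no member, in particular the empty
    chain. *)
Lemma derives_bigcup (S : set (Fm C)) (F : set (set (Fm C))) f :
  total_on F subset -> derives (S `|` \bigcup_(X in F) X) f ->
  derives S f \/ exists2 X, F X & derives (S `|` X) f.
Proof.
move=> totF; elim=> {f} [f [Sf|[X FX Xf]]|f axf|a b _ IHa _ IHb|f axf].
- by left; exact: der_hyp.
- by right; exists X => //; apply: der_hyp; right.
- by left; exact: der_ax.
- have weak (X Y : set (Fm C)) g : X `<=` Y -> derives (S `|` X) g -> derives (S `|` Y) g.
    by move=> XY; apply: derives_weaken => h [|/XY]; [left|right].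
  have weak0 (X : set (Fm C)) g : derives S g -> derives (S `|` X) g.
    by apply: derives_weaken => h; left.
  case: IHa IHb => [da|[X FX da]] [db|[Y FY db]].
  + by left; exact: der_mp da db.
  + by right; exists Y => //; apply: der_mp db; exact: weak0.
  + by right; exists X => //; apply: (der_mp da); exact: weak0.
  + right; have [XY|YX] := totF _ _ FX FY.
      by exists Y => //; apply: der_mp db; exact: weak da.
    by exists X => //; apply: (der_mp da); exact: weak db.
- by left; exact: der_nec.
Qed.

Lemma lindenbaum (S : set (Fm C)) : ~ derives S (fCon bot) ->
  exists T : set (Fm C), [/\ S `<=` T, (forall f, derives T f -> T f) &
    forall f, T (fNot f) <-> ~ T f].
Proof.
(* Zorn's lemma is applied to the sets added to [S], so the empty chain is harmless: its union adds
   nothing to the consistent [S]. *)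
move=> conS; have [|A [conA maxA]] :=
    @Zorn_bigcup _ [set X : set (Fm C) | ~ derives (S `|` X) (fCon bot)].
  by move=> F FP totF /(derives_bigcup totF)[//|[X /FP]].
pose T := S `|` A; have maxT f : T f \/ derives T (fImp f (fCon bot)).
  have [Tf|nTf] := pselect (T f); [by left|right].
  apply: derives_imp; apply: contrapT => conB; apply: (maxA (A `|` [set f])).
    split=> [g Ag|Af]; first by left.
    by apply: nTf; right; apply: Af; right.
  move=> dB; apply: conB; apply: derives_weaken dB => g.
  by move=> [Sg|[Ag|gf]]; [left; left|left; right|right].
have T_closed f : derives T f -> T f.
  by move=> df; have [//|dnf] := maxT f; case: conA; exact: der_mp df dnf.
exists T; split=> // [f Sf|f]; first by left.
split=> [Tnf Tf|nTf].
  apply: conA; apply: (der_mp (der_hyp _ _ Tf)); apply: (der_mp (der_hyp _ _ Tnf)).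
  by apply: (@derives_taut _ _ _ (PImp (PNot (PVar 0)) (PImp (PVar 0) PBot)) [:: f]) =>
    // v /=; case: (v 0).
apply: T_closed; have [//|dnf] := maxT f; apply: (der_mp dnf).
by apply: (@derives_taut _ _ _ (PImp (PImp (PVar 0) PBot) (PNot (PVar 0))) [:: f]) =>
  // v /=; case: (v 0).
Qed.

End Lindenbaum.

(* Every formula over the enlarged language, including those that mention
   witnesses, has its own witness; hence no transfinite tower of languages. *)
Inductive wcon (C : Type) : Type := Old of C | Wit of raw (wcon C).

(** * Witnessing constants and conservativity of the witnessing implications *)

Section Witnesses.
Local Open Scope classical_set_scope.
Variables (C : Type) (top bot : C).
Local Notation D := (wcon C).
Local Notation derives := (derives (Old top) (Old bot)).

(** Nesting depth of witnesses, zero on the original constants. The inner fixpoint follows the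
    recursion of [wcon] through [raw]. *)
Fixpoint rank (d : D) : nat :=
  match d with
  | Old _ => 0
  | Wit f => ((fix rrank (f : raw D) : nat :=
      match f with
      | RVar _ => 0
      | RCon e => rank e
      | RNot g | RBox g | RAll _ g => rrank g
      | RImp g h | ROr g h | RAnd g h | REqv g h => maxn (rrank g) (rrank h)
      end) f).+1
  end.

Lemma rank_Wit (d : D) (f : raw D) : occ f (inr d) -> rank d < rank (Wit f).
Proof.
rewrite /= ltnS; elim: f => //= [c [->//|//]|g IHg h IHh|g IHg h IHh|g IHg h IHh|g IHg h IHh].
all: by move=> /In_cat[/IHg|/IHh] le; rewrite leq_max le ?orbT.
Qed.

Definition witness x (f : Fm D) (hx : x \in fvar f) : D := Wit (fAll x f hx).

Definition henkin x (f : Fm D) (hx : x \in fvar f) : Fm D :=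
  fImp (subst1 f x (fCon (witness hx))) (fAll x f hx).

(** The witness stores its universal formula, so distinct implications never share a witness. *)
Lemma eq_henkin x f (hx : x \in fvar f) x' f' (hx' : x' \in fvar f') :
  witness hx = witness hx' -> henkin hx = henkin hx'.
Proof.
case=> xx' /Fm_inj ff'; move: hx hx'; rewrite xx' ff' => hx hx'.
by rewrite (bool_irrelevance hx hx').
Qed.

Lemma occ_henkin x f (hx : x \in fvar f) d : occ (henkin hx) (inr d) ->
  d = witness hx \/ rank d < rank (witness hx).
Proof.
move=> /occ_imp[/occ_rsubst[[z|e] uf]|df] /=; last by right; exact: rank_Wit.
  by rewrite /upd; case: eqP => //= _ [->|//]; left.
by move=> [<-|//]; right; exact: rank_Wit.
Qed.

(** Refuting an implication classically proves its antecedent and refutes its conclusion; as the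
    witness is fresh, the antecedent generalizes to the conclusion, a contradiction. *)
Lemma henkin_step (Phi : set (Fm D)) x f (hx : x \in fvar f) :
  (forall g, Phi g -> ~ occ g (inr (witness hx))) ->
  derives (fun g => Phi g \/ g = henkin hx) (fCon (Old bot)) ->
  derives Phi (fCon (Old bot)).
Proof.
move=> cP dP; have dH := derives_imp dP.
set B := fAll x f hx; set A := subst1 f x (fCon (witness hx)).
have dA : derives Phi A.
  apply: (der_mp dH); apply: (@derives_taut _ _ _
    (PImp (PImp (PImp (PVar 0) (PVar 1)) PBot) (PVar 0)) [:: A; B]) => // v /=.
  by case: (v 0); case: (v 1).
have dB : derives Phi B.
  (* By rank, the witness does not occur in the formula it witnesses. *)
  apply: (derives_gen_con hx _ _ _ cP dA) => // fw.
  by have := @rank_Wit (witness hx) (fAll x f hx) fw; rewrite ltnn.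
apply: (der_mp dB); apply: (der_mp dH); apply: (@derives_taut _ _ _
  (PImp (PImp (PImp (PVar 0) (PVar 1)) PBot) (PImp (PVar 1) PBot)) [:: A; B]) => // v /=.
by case: (v 0); case: (v 1).
Qed.

Definition henkin_upto n : set (Fm D) := fun g =>
  exists x f (hx : x \in fvar f), rank (witness hx) <= n /\ g = henkin hx.

(** A witness of rank [n.+1] occurs neither in [Phi] nor in another implication of that rank, so the
    implications in [l] can be removed one by one with [henkin_step]. *)
Lemma henkin_list (Phi : set (Fm D)) n (l : seq (Fm D)) :
  (forall g d, Phi g -> occ g (inr d) -> rank d <= n) ->
  (forall g, List.In g l -> Phi g \/
     exists x f (hx : x \in fvar f), rank (witness hx) = n.+1 /\ g = henkin hx) ->
  derives (fun g => Phi g \/ List.In g l) (fCon (Old bot)) ->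
  derives Phi (fCon (Old bot)).
Proof.
move=> Pn; elim: l => [|h l IH] lP dl.
  by apply: derives_weaken dl => g [].
have lP' g : List.In g l -> Phi g \/
    exists x f (hx : x \in fvar f), rank (witness hx) = n.+1 /\ g = henkin hx.
  by move=> gl; apply: lP; right.
apply: (IH lP').
(* A repeated implication is dropped first, so that [h] differs from the rest of the list. *)
have [Ph|nPh] := pselect (Phi h \/ List.In h l).
  by apply: derives_weaken dl => g [|[<-//|]]; [left|right].
have [Ph|[x [f [hx [rn hE]]]]] := lP h (or_introl erefl); first by case: nPh; left.
apply: (@henkin_step _ x f hx); last first.
  by apply: derives_weaken dl => g [|[<-|]]; [left; left|right|left; right].
have Pocc g : Phi g -> ~ occ g (inr (witness hx)).
  by move=> Pg /(Pn _ _ Pg); rewrite rn ltnn.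
move=> g [|gl]; first exact: Pocc.
have [|[x' [f' [hx' [rn' gE]]]]] := lP' g gl; first exact: Pocc.
rewrite gE => /occ_henkin[/eq_henkin E|]; last by rewrite rn rn' ltnn.
by apply: nPh; right; rewrite hE E -gE.
Qed.

Lemma henkin_upto_conservative (Phi : set (Fm D)) n :
  (forall g d, Phi g -> occ g (inr d) -> rank d = 0) ->
  derives (Phi `|` henkin_upto n) (fCon (Old bot)) ->
  derives Phi (fCon (Old bot)).
Proof.
move=> P0; elim: n => [|n IH].
  (* Witnesses have positive rank, so [henkin_upto 0] is empty. *)
  by apply: derives_weaken => g [//|[x [f [hx []]]]].
(* Finitely many implications of rank [n.+1] are used; they are removed over [Phi] together with all
   lower ranks. *)
move=> dP; have [l lP dl] := derives_finite dP; apply: IH; apply: (@henkin_list _ n l).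
- move=> g d [Pg|[x [f [hx [rn ->]]]]]; first by move/(P0 _ _ Pg) ->.
  by move=> /occ_henkin[->//|/ltnW dn]; exact: leq_trans dn rn.
- move=> g /lP[Pg|[x [f [hx []]]]]; first by left; left.
  rewrite leq_eqVlt => /predU1P[rn|rn] gE; first by right; exists x, f, hx.
  by left; right; exists x, f, hx.
by apply: derives_weaken dl => g; right.
Qed.

(** A derivation uses finitely many implications, so their ranks are bounded. *)
Lemma henkin_conservative (Phi : set (Fm D)) :
  (forall g d, Phi g -> occ g (inr d) -> rank d = 0) ->
  derives (fun g => Phi g \/ exists x f (hx : x \in fvar f), g = henkin hx)
    (fCon (Old bot)) ->
  derives Phi (fCon (Old bot)).
Proof.
move=> P0 dP; suff [n] : exists n, derives (Phi `|` henkin_upto n) (fCon (Old bot)).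
  exact: henkin_upto_conservative.
elim: dP => [f [Pf|[x [k [hx fE]]]]|f axf|a b _ [m da] _ [n db]|f axf].
- by exists 0; apply: der_hyp; left.
- by exists (rank (witness hx)); apply: der_hyp; right; exists x, k, hx.
- by exists 0; exact: der_ax.
- exists (maxn m n); apply: der_mp; [apply: derives_weaken da|apply: derives_weaken db];
  by move=> g [|[x [k [hx [rn gE]]]]]; [left|right; exists x, k, hx; rewrite leq_max rn ?orbT].
- by exists 0; exact: der_nec.
Qed.

(** A left inverse of [Old], by which derivations over the enlarged language project back; witnesses
    get the arbitrary value [top]. *)
Definition unwit (d : D) : C := if d is Old c then c else top.

Lemma fmap_unwitK f : fmap unwit (fmap (@Old C) f) = f.
Proof.
apply: Fm_inj => /=; elim: (fraw f) => //= [g ->|g ->|g -> h ->|g -> h ->|g -> h ->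
  |g -> h ->|x g ->] //.
Qed.

Lemma fmap_Old_conservative (Phi : set (Fm C)) f :
  derives (fun g => exists2 h, Phi h & g = fmap (@Old C) h) (fmap (@Old C) f) ->
  Defs.derives top bot Phi f.
Proof.
move=> /(derives_fmap unwit); rewrite fmap_unwitK; apply: derives_weaken => g.
by move=> [_ [h Ph ->] ->]; rewrite fmap_unwitK.
Qed.

Lemma rank_fmap_Old f d : occ (fmap (@Old C) f) (inr d) -> rank d = 0.
Proof.
rewrite /= rcon_rmap; elim: (rcon f) => //= c l IH [<-//|]; exact: IH.
Qed.

End Witnesses.

(** * Soundness by induction on derivations, completeness by a countermodel *)

Lemma soundness (C : Type) (top bot : C) (Phi : Fm C -> Prop) (phi : Fm C) :
  derives top bot Phi phi -> entails top bot Phi phi.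
Proof.
move=> dphi M admM g gPhi; elim: dphi => {phi} [f /gPhi//|f axf|a b _ Ta _ Tab|f axf].
- by apply: NEC_TRUE; exact: admM.
- by move/true_imp: Tab => [].
- by apply/true_box; exact: admM.
Qed.

Lemma completeness (C : Type) (top bot : C) (Phi : Fm C -> Prop) (phi : Fm C) :
  entails top bot Phi phi -> derives top bot Phi phi.
Proof.
move=> ent; apply: contrapT => ndphi; pose emb := fmap (@Old C).
(* The negation of [phi] joins the embedded premises; all constants here are old, so they have rank
   zero and no witness occurs. *)
pose S0 : set (Fm (wcon C)) := fun g => (exists2 h, Phi h & g = emb h) \/ g = fNot (emb phi).
have S0_rank g d : S0 g -> occ g (inr d) -> rank d = 0.
  by move=> [[h _ ->]|->]; exact: rank_fmap_Old.
have conS0 : ~ derives (Old top) (Old bot) S0 (fCon (Old bot)).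
  move=> dbot; have dphi := derives_imp dbot.
  apply/ndphi/fmap_Old_conservative; apply: (der_mp dphi).
  by apply: (@derives_taut _ _ _ (PImp (PImp (PNot (PVar 0)) PBot) (PVar 0)) [:: emb phi]) =>
    // v /=; case: (v 0).
(* By conservativity [S0] stays consistent with all witnessing implications added; [T] is a maximal
   extension of the result. *)
have [T [ST T_closed T_not]] := lindenbaum (contra_not (henkin_conservative S0_rank) conS0).
have T_wit x f (hx : x \in fvar f) : exists c, T (subst1 f x (fCon c)) -> T (fAll x f hx).
  exists (witness hx) => Tf; apply: T_closed; apply: (der_mp (der_hyp _ _ Tf)).
  by apply: der_hyp; apply: ST; right; exists x, f, hx.
have [M admM [g gT]] := canonical_model T_closed T_not T_wit.
have [N admN /(_ g)[g' g'E]] := model_reduct admM.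
have : satisfies g' phi.
  by apply: ent => // h Ph; apply/g'E/gT/ST; left; left; exists h.
by move/g'E/gT; apply/T_not/ST; left; right.
Qed.

Theorem theorem41 (C : Type) (top bot : C) (Phi : Fm C -> Prop) (phi : Fm C) :
  derives top bot Phi phi <-> entails top bot Phi phi.
Proof. by split; [exact: soundness|exact: completeness]. Qed.
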